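(* Let $d\ge 2$, $p\ge 1$, and let $C>0$ be admissible. Then $\mathrm{DSW}_p(\cdot,\cdot;C)$ is a well-defined metric on $\mathcal{P}_p(\mathbb{R}^d)$, the space of Borel probability measures on $\mathbb{R}^d$ with finite $p$-th moment. In particular, for all $\mu,\nu,\eta\in\mathcal{P}_p(\mathbb{R}^d)$: $\mathrm{DSW}_p(\mu,\nu;C)\ge 0$; $\mathrm{DSW}_p(\mu,\nu;C)=\mathrm{DSW}_p(\nu,\mu;C)$; $\mathrm{DSW}_p(\mu,\nu;C)=0$ if and only if $\mu=\nu$; and $\mathrm{DSW}_p(\mu,\nu;C)\le \mathrm{DSW}_p(\mu,\eta;C)+\mathrm{DSW}_p(\eta,\nu;C)$.
   Context: $\mathbb{S}^{d-1}$ is the unit sphere of $\mathbb{R}^d$ in the Euclidean norm. For a Borel probability measure $\mu$ on $\mathbb{R}^d$ and $\theta\in\mathbb{S}^{d-1}$, let $\mathcal{R}\mu(\cdot,\theta)$ denote the one-dimensional probability measure obtained as the pushforward of $\mu$ under $x\mapsto\langle x,\theta\rangle$ (the Radon transform of $\mu$ in direction $\theta$). $W_p$ denotes the Wasserstein distance of order $p$ (with Euclidean ground cost). A constant $C>0$ is called admissible if the set $\mathbb{M}_C$ of Borel probability measures $\sigma$ on $\mathbb{S}^{d-1}$ satisfying $\mathbb{E}_{\theta,\theta'\sim\sigma}[|\theta^\top\theta'|]\le C$ (with $\theta,\theta'$ independent) is nonempty. For admissible $C$, the distributional sliced-Wasserstein distance is $$\mathrm{DSW}_p(\mu,\nu;C)=\sup_{\sigma\in\mathbb{M}_C}\Big(\mathbb{E}_{\theta\sim\sigma}\big[W_p^p(\mathcal{R}\mu(\cdot,\theta),\mathcal{R}\nu(\cdot,\theta))\big]\Big)^{1/p}.$$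 *)

(* Defs.v *)
From HB Require Import structures.
From mathcomp Require Import all_boot all_order all_algebra.
From mathcomp Require Import all_classical all_reals all_analysis.
Set Implicit Arguments. Unset Strict Implicit. Unset Printing Implicit Defensive.
Import Order.TTheory GRing.Theory Num.Theory.
Import numFieldNormedType.Exports.
Local Open Scope classical_set_scope.
Local Open Scope ring_scope.

(* R^d with its Borel sigma-algebra (generated by the open sets of the
   product topology on row vectors, which is the Euclidean topology). *)
Notation Rd R d := (g_sigma_algebraType (@open 'rV[R]_d)).

Definition dotv (R : realType) (d : nat) (x y : 'rV[R]_d) : R :=
  \sum_(i < d) x 0 i * y 0 i.
Definition enorm (R : realType) (d : nat) (x : 'rV[R]_d) : R :=
  Num.sqrt (dotv x x).

Definition sphere (R : realType) (d : nat) : set 'rV[R]_d :=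
  [set x | enorm x = 1].

Definition radon (R : realType) (d : nat) (mu : set (Rd R d) -> \bar R)
  (theta : 'rV[R]_d) : set R -> \bar R :=
  fun A => mu ((fun x : 'rV[R]_d => dotv x theta) @^-1` A).

(* couplings of two (one-dimensional) measures, given as set functions
   whose values matter on Borel sets of R *)
Definition coupling (R : realType) (a b : set R -> \bar R)
  (pi : probability (R * R)%type R) : Prop :=
  forall A : set R, measurable A ->
    pi (fst @^-1` A) = a A /\ pi (snd @^-1` A) = b A.

Definition Wpp (R : realType) (p : R) (a b : set R -> \bar R) : \bar R :=
  ereal_inf [set (\int[pi]_z ((`|z.1 - z.2| `^ p)%:E))%E
            | pi in [set pi | coupling a b pi]].

(* M_C : Borel probability measures on the sphere (represented as Borel
   probability measures on R^d giving full mass to S^{d-1}) with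
   E_{theta,theta' ~ sigma} |theta^T theta'| <= C *)
Definition MC (R : realType) (d : nat) (C : R) : set (probability (Rd R d) R) :=
  [set s : probability (Rd R d) R | s (~` @sphere R d) = 0%E /\
           (\int[s]_t \int[s]_t' (`|dotv t t'|)%:E <= C%:E)%E].

Arguments MC {R} d C.

Definition admissible (R : realType) (d : nat) (C : R) : Prop :=
  MC d C !=set0.

Arguments admissible {R} d C.

Definition DSW (R : realType) (d : nat) (p C : R)
  (mu nu : probability (Rd R d) R) : \bar R :=
  ereal_sup [set poweR (\int[s]_t Wpp p (radon mu t) (radon nu t))%E p^-1
            | s in MC d C].

Arguments DSW {R d} p C mu nu.

Definition Pp (R : realType) (d : nat) (p : R) : set (probability (Rd R d) R) :=
  [set mu : probability (Rd R d) R | (\int[mu]_x ((enorm x) `^ p)%:E < +oo)%E].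

Arguments Pp {R} d p.

(* Main.v *)
(* The function W_p(R mu(., t), R nu(., t)) is Lipschitz in the direction t,
   hence integrable against every sigma in M_C, and the triangle inequality is
   Minkowski in L^p(sigma) applied to the one for W_p on the line.  The latter
   needs no disintegration: two couplings are glued along their common marginal
   after rounding it to a grid of mesh e, the two middle points being then
   independent within each cell, which costs at most e.

   Admissibility forces 1/d <= C, because
   E|t.t'| >= E(t.t')^2 >= (tr E(t t^T))^2 / d = 1/d on the sphere; so the
   uniform measure on any orthonormal basis lies in M_C, and every direction is
   an atom of some sigma in M_C.  If DSW vanishes, all projections of mu and nu
   thus have the same integrals against cosines, and mu and nu agree on
   trigonometric polynomials.  Orthants are bounded pointwise limits of these:
   (1 - s^n)^(n 2^n) tends to the indicator of s < 1/2 on [0, 1], which, for s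
   = (1 + sin((x_i - a_i)/m))/2 and m large, isolates x_i < a_i. *)
Require Import Defs.
From HB Require Import structures.
From mathcomp Require Import all_boot all_order all_algebra.
From mathcomp Require Import all_classical all_reals all_analysis.
From mathcomp Require Import measurable_realfun ring lra.
Set Implicit Arguments. Unset Strict Implicit. Unset Printing Implicit Defensive.
Import Order.TTheory GRing.Theory Num.Theory.
Import numFieldNormedType.Exports.
Local Open Scope classical_set_scope.
Local Open Scope ring_scope.

(** * Gluing of couplings *)

Section gluing.
Local Open Scope ereal_scope.

Lemma measure_sum_fibres d (T : measurableType d) (R : realType)
    (m : {measure set T -> \bar R}) (h : T -> nat) (A : set T) :
  (forall k, measurable (h @^-1` [set k])) -> measurable A ->
  \sum_(0 <= k <oo) m (A `&` h @^-1` [set k]) = m A.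
Proof.
move=> mh mA; rewrite -measure_semi_bigcup//.
- rewrite -setI_bigcupr (_ : \bigcup_k _ = setT) ?setIT//.
  by rewrite -subTset => x _; exists (h x).
- by move=> i; exact: measurableI.
- apply/trivIsetP => i j _ _ /eqP ij; rewrite -subset0 => x [[_ /= hi] [_ /= hj]].
  by apply: ij; rewrite -hi.
- by apply: bigcupT_measurable => i; exact: measurableI.
Qed.

(** The equation covers all sets, not only measurable ones, so that the law of [dotv x t] under [mu]
    equals [radon mu t] as a set function. *)
Lemma pushforward_probability d1 d2 (X : measurableType d1)
    (Y : measurableType d2) (R : realType) (P : probability X R) (f : X -> Y) :
  measurable_fun setT f ->
  exists Q : probability Y R, forall A, Q A = P (f @^-1` A).
Proof.
move=> mf; pose fm := isMeasurableFun.Build _ _ _ _ _ mf.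
pose F : {mfun X >-> Y} := HB.pack f fm.
by exists (distribution P F).
Qed.

Context d1 d2 (X : measurableType d1) (Y : measurableType d2) (R : realType).

(* The two coordinates are independent given the common value of f and g. *)
Lemma exists_coupling_along (P : probability X R) (Q : probability Y R)
    (f : X -> nat) (g : Y -> nat) :
  (forall k, measurable (f @^-1` [set k])) ->
  (forall k, measurable (g @^-1` [set k])) ->
  (forall k, P (f @^-1` [set k]) = Q (g @^-1` [set k])) ->
  exists G : probability (X * Y)%type R,
    [/\ forall A, measurable A -> G (fst @^-1` A) = P A,
        forall B, measurable B -> G (snd @^-1` B) = Q B
      & G [set z | f z.1 != g z.2] = 0].
Proof.
move=> mf mg PQ.
pose E k := (f @^-1` [set k]) `*` (g @^-1` [set k]).
have mE k : measurable (E k) by exact: measurableX.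
(* [G0] below sums over k the product measure cut to [E k] and divided by the mass of the fibre; a
   null fibre gets the weight [0^-1 = 0]. *)
have w_ge0 k : (0 <= (fine (P (f @^-1` [set k])))^-1)%R.
  by rewrite invr_ge0 fine_ge0.
pose m_ k : {measure set (X * Y) -> \bar R} :=
  mscale (NngNum (w_ge0 k)) (mrestr (P \x Q) (mE k)).
pose G0 : {measure set (X * Y) -> \bar R} := mseries m_ 0.
have mX k (A : set X) (B : set Y) : measurable A -> measurable B ->
    m_ k (A `*` B) = ((fine (P (f @^-1` [set k])))^-1)%:E *
      (P (A `&` f @^-1` [set k]) * Q (B `&` g @^-1` [set k])).
  move=> mA mB; rewrite /m_ /= /mscale/= /mrestr -setXI -product_measure1E//.
  - exact: measurableI.
  - exact: measurableI.
(* Here x will be the mass of a part of the k-th fibre; if the fibre is null then x = 0 too, so the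
   default value of the inverse does no harm. *)
have cancel k x : x <= P (f @^-1` [set k]) -> 0 <= x ->
    ((fine (P (f @^-1` [set k])))^-1)%:E * (x * P (f @^-1` [set k])) = x.
  move=> xP x0; have [P0|P0] := eqVneq (P (f @^-1` [set k])) 0.
    by rewrite P0 !mule0; apply/esym/eqP; rewrite eq_le x0 -P0 xP.
  have Pfin : P (f @^-1` [set k]) \is a fin_num by exact: fin_num_measure.
  rewrite -{2}(fineK Pfin) muleCA -EFinM mulVf ?mule1//.
  by rewrite fine_eq0.
have G0X A : measurable A -> G0 (fst @^-1` A) = P A.
  move=> mA; rewrite -(measure_sum_fibres P mf mA) /G0 /= /mseries.
  apply: eq_eseriesr => k _.
  rewrite -[fst @^-1` A](_ : A `*` setT = _); last first.
    by apply/seteqP; split => z; [case|].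
  rewrite mX// setTI -PQ cancel ?measure_ge0//.
  by apply: le_measure; rewrite ?inE//; exact: measurableI.
have G0Y B : measurable B -> G0 (snd @^-1` B) = Q B.
  move=> mB; rewrite -(measure_sum_fibres Q mg mB) /G0 /= /mseries.
  apply: eq_eseriesr => k _.
  rewrite -[snd @^-1` B](_ : setT `*` B = _); last first.
    by apply/seteqP; split => z; [case|].
  rewrite mX// setTI [P _ * _]muleC cancel ?measure_ge0//.
  by rewrite PQ; apply: le_measure; rewrite ?inE//; exact: measurableI.
have G0T : G0 setT = 1 by rewrite -(preimage_setT fst) G0X// probability_setT.
pose Gm := Measure_isProbability.Build _ _ _ (mseries m_ 0) G0T.
pose G : probability (X * Y)%type R := HB.pack (mseries m_ 0) Gm.
exists G; split => //.
rewrite /G /= /mseries eseries0// => k _ _ /=.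
rewrite /mscale /= /mrestr (_ : _ `&` _ = set0) ?measure0 ?mule0//.
by rewrite -subset0 => z [/= /eqP fg [/= fk gk]]; apply: fg; rewrite fk gk.
Qed.

End gluing.

(** * The triangle inequality for the Wasserstein distance on the line *)

Section wasserstein.
Local Open Scope ereal_scope.
Context (R : realType).

Lemma LnormEFinE d (T : measurableType d) (m : {measure set T -> \bar R}) (p : R)
    (f : T -> R) :
  'N[m]_p%:E[EFin \o f] = (\int[m]_x (`|f x| `^ p)%:E) `^ p^-1.
Proof. by rewrite unlock. Qed.

Lemma measurable_powR_normr d (T : measurableType d) (p : R) (f : T -> R) :
  measurable_fun setT f ->
  measurable_fun setT (fun x => (`|f x| `^ p)%:E : \bar R).
Proof.
move=> mf; apply/measurable_EFinP.
apply: (measurableT_comp (measurable_powR p)).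
exact: (measurableT_comp (@normr_measurable _ setT)).
Qed.

Lemma Lnorm_pushforward d1 d2 (X : measurableType d1) (Y : measurableType d2)
    (m : {measure set X -> \bar R}) (m' : {measure set Y -> \bar R}) (h : X -> Y)
    (p : R) (f : Y -> R) :
  measurable_fun setT h -> measurable_fun setT f ->
  (forall A, measurable A -> m' A = m (h @^-1` A)) ->
  'N[m']_p%:E[EFin \o f] = 'N[m]_p%:E[EFin \o (f \o h)].
Proof.
move=> mh mf m'E; rewrite !LnormEFinE; congr (_ `^ _).
rewrite -[RHS](@ge0_integral_pushforward _ _ _ _ _ h mh m setT
  (fun y => (`|f y| `^ p)%:E))//; last exact: measurable_powR_normr.
by apply: eq_measure_integral => A mA _; exact: m'E.
Qed.

Lemma le_Lnorm_cst d (T : measurableType d) (m : probability T R) (p e : R)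
    (f : T -> R) : (1 <= p)%R -> (0 <= e)%R -> measurable_fun setT f ->
  (\forall x \ae m, (`|f x| <= e)%R) -> 'N[m]_p%:E[EFin \o f] <= e%:E.
Proof.
move=> p1 e0 mf fe; have p0 : (0 < p)%R by exact: lt_le_trans p1.
rewrite LnormEFinE.
have -> : e%:E = (e `^ p)%:E `^ p^-1 :> \bar R.
  by rewrite poweR_EFin -powRrM mulfV ?gt_eqF// powRr1.
apply: gt0_ler_poweR.
- by rewrite invr_ge0 ltW.
- by rewrite in_itv/= leey andbT; apply: integral_ge0 => x _; rewrite lee_fin powR_ge0.
- by rewrite in_itv/= leey andbT lee_fin powR_ge0.
rewrite (_ : (e `^ p)%:E = \int[m]_x (cst (e `^ p)%:E x)); last first.
  rewrite integral_cst// -[LHS]mule1; congr (_ * _).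
  exact/esym/probability_setT.
apply: ae_ge0_le_integral => //.
- exact: measurable_powR_normr.
- by move=> x _; rewrite lee_fin powR_ge0.
apply: filterS fe => x fe _ /=; rewrite lee_fin.
by apply: ge0_ler_powR; rewrite ?nnegrE // ltW.
Qed.

(** The p-th root is an increasing bijection of [0, +oo] with inverse the p-th power. This carries
    bounds on the roots of single costs over to the root of the infimum [Wpp]. *)
Lemma poweR_ereal_inf_ge (S : set (\bar R)) (p : R) (x : \bar R) : (0 < p)%R ->
  0 <= x -> (forall s, S s -> 0 <= s /\ x <= s `^ p^-1) -> x <= ereal_inf S `^ p^-1.
Proof.
move=> p0 x0 xS.
have pK y : 0 <= y -> (y `^ p) `^ p^-1 = y.
  by move=> y0; rewrite -poweRrM mulfV ?gt_eqF// poweRe1.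
have pK' y : 0 <= y -> (y `^ p^-1) `^ p = y.
  by move=> y0; rewrite -poweRrM mulVf ?gt_eqF// poweRe1.
rewrite -[leLHS]pK//; apply: gt0_ler_poweR.
- by rewrite invr_ge0 ltW.
- by rewrite in_itv/= leey andbT poweR_ge0.
- rewrite in_itv/= leey andbT; apply: le_ereal_inf_tmp => s Ss.
  by have [] := xS _ Ss.
apply: le_ereal_inf_tmp => s Ss; have [s0 xs] := xS _ Ss.
rewrite -[leRHS]pK'//; apply: gt0_ler_poweR => //.
- exact: ltW.
- by rewrite in_itv/= leey x0.
- by rewrite in_itv/= leey poweR_ge0.
Qed.

Lemma exists_discretization (e : R) : (0 < e)%R ->
  exists h : R -> nat, (forall k, measurable (h @^-1` [set k])) /\
    (forall x y, h x = h y -> `|x - y| <= e)%R.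
Proof.
move=> e0; exists (fun x => pickle (Num.floor (x / e))); split => [k|x y].
  have floorE (n : int) (x : R) : (n = Num.floor (x / e)) <->
      x \in `[(n%:~R * e)%R, ((n + 1)%:~R * e)%R[.
    rewrite in_itv/= -ler_pdivlMr// -ltr_pdivrMr//; split => [->|].
      exact: floor_itv.
    by move=> /floor_def.
  have [[n <-]|kN] := pselect (exists n : int, pickle n = k); last first.
    rewrite (_ : _ @^-1` _ = set0)// -subset0 => x /= xk; apply: kN.
    by exists (Num.floor (x / e)).
  rewrite (_ : _ @^-1` _ = `[(n%:~R * e)%R, ((n + 1)%:~R * e)%R[%classic).
    exact: measurable_itv.
  apply/seteqP; split => x /=; first by move=> /(pcan_inj pickleK) /esym/floorE.
  by move=> /floorE <-.
move=> /(pcan_inj pickleK) xy.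
have /andP[] := floor_itv (x / e); have /andP[] := floor_itv (y / e).
rewrite -xy; set n := Num.floor _.
rewrite !ler_pdivlMr// !ltr_pdivrMr// rmorphD/= mulrDl mul1r => *.
by rewrite ler_norml; apply/andP; split; lra.
Qed.

Lemma Wpp_le (p : R) (a b : set R -> \bar R) (pi : probability (R * R)%type R) :
  coupling a b pi -> Wpp p a b <= \int[pi]_z (`|z.1 - z.2| `^ p)%:E.
Proof. by move=> abpi; apply: ereal_inf_lbound; exists pi. Qed.

Lemma Wpp_ge0 (p : R) (a b : set R -> \bar R) : 0 <= Wpp p a b.
Proof.
apply: le_ereal_inf_tmp => _ [pi _ <-].
by apply: integral_ge0 => z _; rewrite lee_fin powR_ge0.
Qed.

(** Glue the two couplings on the cells of the discretized b-marginal, and compare [a] with [c]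
    through the outer coordinates. *)
Lemma coupling_comp (p : R) (a b c : set R -> \bar R)
    (pi1 pi2 : probability (R * R)%type R) : (1 <= p)%R ->
  coupling a b pi1 -> coupling b c pi2 ->
  Wpp p a c `^ p^-1 <= 'N[pi1]_p%:E[EFin \o (fun z => z.1 - z.2)%R] +
                       'N[pi2]_p%:E[EFin \o (fun z => z.1 - z.2)%R].
Proof.
move=> p1 ab bc; have p0 : (0 < p)%R by exact: lt_le_trans p1.
apply/lee_addgt0Pr => e e0.
have [h [mh he]] := exists_discretization e0.
have mdiff : measurable_fun setT (fun z : R * R => z.1 - z.2)%R.
  by apply: measurable_funB; [exact: measurable_fst|exact: measurable_snd].
have mh1 k : measurable ((fun z : R * R => h z.2) @^-1` [set k]).
  rewrite -[X in measurable X]setTI.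
  exact: (@measurable_snd _ _ R R measurableT (h @^-1` [set k])).
have mh2 k : measurable ((fun z : R * R => h z.1) @^-1` [set k]).
  rewrite -[X in measurable X]setTI.
  exact: (@measurable_fst _ _ R R measurableT (h @^-1` [set k])).
(* Both sides are the mass that [b] gives to the k-th cell. *)
have pi12 k : pi1 ((fun z => h z.2) @^-1` [set k]) =
              pi2 ((fun z => h z.1) @^-1` [set k]).
  have [_ ->] := ab _ (mh k).
  by have [-> _] := bc _ (mh k).
have [G [G1 G2 G0]] := exists_coupling_along mh1 mh2 pi12.
pose F := fun z : (R * R) * (R * R) => (z.1.1, z.2.2).
have m11 : measurable_fun setT (fun z : (R * R) * (R * R) => z.1.1).
  by apply: (measurableT_comp measurable_fst); exact: measurable_fst.
have m12 : measurable_fun setT (fun z : (R * R) * (R * R) => z.1.2).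
  by apply: (measurableT_comp measurable_snd); exact: measurable_fst.
have m21 : measurable_fun setT (fun z : (R * R) * (R * R) => z.2.1).
  by apply: (measurableT_comp measurable_fst); exact: measurable_snd.
have m22 : measurable_fun setT (fun z : (R * R) * (R * R) => z.2.2).
  by apply: (measurableT_comp measurable_snd); exact: measurable_snd.
have mF : measurable_fun setT F by exact: measurable_fun_pair.
have [pi piE] := pushforward_probability G mF.
have ac : coupling a c pi.
  move=> A mA; rewrite !piE; split.
  - have [<- _] := ab _ mA; rewrite -G1//.
    by rewrite -[X in measurable X]setTI; exact: measurable_fst.
  - have [_ <-] := bc _ mA; rewrite -G2//.
    by rewrite -[X in measurable X]setTI; exact: measurable_snd.
apply: (@le_trans _ _ 'N[pi]_p%:E[EFin \o (fun z => z.1 - z.2)%R]).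
  rewrite LnormEFinE; apply: gt0_ler_poweR.
  - by rewrite invr_ge0 ltW.
  - by rewrite in_itv/= leey Wpp_ge0.
  - rewrite in_itv/= leey andbT; apply: integral_ge0 => z _.
    by rewrite lee_fin powR_ge0.
  - exact: Wpp_le.
rewrite (Lnorm_pushforward p mF mdiff (m := G)); last by move=> A _; exact: piE.
rewrite (Lnorm_pushforward p measurable_fst mdiff (m := G)); last first.
  by move=> A mA; exact/esym/G1.
rewrite (Lnorm_pushforward p measurable_snd mdiff (m := G)); last first.
  by move=> A mA; exact/esym/G2.
(* x - z = (x - y) + (y' - z) + (y - y'); the last term is at most e almost everywhere, since G puts
   y and y' in one cell. *)
rewrite (_ : _ \o F = ((fun z : R * R => z.1 - z.2)%R \o fst) \+
    (((fun z : R * R => z.1 - z.2)%R \o snd) \+ (fun z => z.1.2 - z.2.1)))%R; last first.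
  by apply/funext => -[[x y] [y' z]] /=; ring.
have mfst : measurable_fun setT ((fun z : R * R => z.1 - z.2)%R \o
    (fst : (R * R) * (R * R) -> R * R)) by exact: measurable_funB.
have msnd : measurable_fun setT ((fun z : R * R => z.1 - z.2)%R \o
    (snd : (R * R) * (R * R) -> R * R)) by exact: measurable_funB.
have mmid : measurable_fun setT (fun z : (R * R) * (R * R) => z.1.2 - z.2.1)%R.
  exact: measurable_funB.
apply: (le_trans (minkowski_EFin _ _ _ p1)) => //; first exact: measurable_funD.
rewrite -addeA leeD2l//.
apply: (le_trans (minkowski_EFin _ _ _ p1)) => //; rewrite leeD2l//.
apply: le_Lnorm_cst => //; first exact: ltW.
have mD : measurable [set z : (R * R) * (R * R) | h z.1.2 != h z.2.1].
  rewrite (_ : [set _ | _] = ~` \bigcup_k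
     (((fun z : R * R => h z.2) @^-1` [set k]) `*`
      ((fun z : R * R => h z.1) @^-1` [set k]))).
    by apply: measurableC; apply: bigcupT_measurable => k; exact: measurableX.
  apply/seteqP; split => z /=.
    by move=> /eqP hh [k _ [/= h1 h2]]; apply: hh; rewrite h1 h2.
  by move=> nh; apply/eqP => hh; apply: nh; exists (h z.1.2) => //; split.
exists [set z : (R * R) * (R * R) | h z.1.2 != h z.2.1]; split => // z /=.
by apply: contra_notP => /negP; rewrite negbK => /eqP /he.
Qed.

(** The two infima are taken one after the other: first over couplings of a and b with that of b and
    c fixed, then over the latter. Each time the other summand is moved to the left, which calls for
    it to be finite and for a non-negative difference; hence the case distinctions. *)
Lemma Wpp_triangle (p : R) (a b c : set R -> \bar R) : (1 <= p)%R ->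
  Wpp p a c `^ p^-1 <= Wpp p a b `^ p^-1 + Wpp p b c `^ p^-1.
Proof.
move=> p1; have p0 : (0 < p)%R by exact: lt_le_trans p1.
have cost0 (pi : probability (R * R)%type R) :
    0 <= \int[pi]_z (`|z.1 - z.2| `^ p)%:E.
  by apply: integral_ge0 => z _; rewrite lee_fin powR_ge0.
have h1 (pi : probability (R * R)%type R) : coupling b c pi ->
    Wpp p a c `^ p^-1 <= Wpp p a b `^ p^-1 + 'N[pi]_p%:E[EFin \o (fun z => z.1 - z.2)%R].
  move=> bc; have [->|Nfin] := eqVneq 'N[pi]_p%:E[EFin \o (fun z => z.1 - z.2)%R] +oo.
    by rewrite addey ?leey// gt_eqF// (lt_le_trans _ (poweR_ge0 _ _)).
  have Nf : 'N[pi]_p%:E[EFin \o (fun z => z.1 - z.2)%R] \is a fin_num.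
    by rewrite ge0_fin_numE ?Lnorm_ge0// ltey.
  have [le0|gt0] := leP (Wpp p a c `^ p^-1)
      'N[pi]_p%:E[EFin \o (fun z => z.1 - z.2)%R].
    by rewrite (le_trans le0)// leeDr// poweR_ge0.
  rewrite -leeBlDr//; apply: poweR_ereal_inf_ge => //.
    by rewrite sube_ge0// ?ltW// Nf.
  by move=> _ [pi' ab <-]; split => //; rewrite leeBlDr// -LnormEFinE (coupling_comp p1 ab).
have [->|Wfin] := eqVneq (Wpp p a b `^ p^-1) +oo.
  by rewrite addye ?leey// gt_eqF// (lt_le_trans _ (poweR_ge0 _ _)).
have Wf : Wpp p a b `^ p^-1 \is a fin_num.
  by rewrite ge0_fin_numE ?poweR_ge0// ltey.
have [le0|gt0] := leP (Wpp p a c `^ p^-1) (Wpp p a b `^ p^-1).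
  by rewrite (le_trans le0)// leeDl// poweR_ge0.
rewrite -leeBlDl//; apply: poweR_ereal_inf_ge => //.
  by rewrite sube_ge0// ?ltW// Wf.
by move=> _ [pi' bc <-]; split => //; rewrite leeBlDl// -LnormEFinE h1.
Qed.

End wasserstein.

(** * Dependence on the direction *)

Section euclidean.
Context (R : realType) (d : nat).
Implicit Types x y z : 'rV[R]_d.

Lemma dotvC x y : dotv x y = dotv y x.
Proof. by apply: eq_bigr => i _; rewrite mulrC. Qed.

Lemma dotvDl x y z : dotv (x + y) z = dotv x z + dotv y z.
Proof. by rewrite -big_split; apply: eq_bigr => i _; rewrite mxE mulrDl. Qed.

Lemma dotvZl a x y : dotv (a *: x) y = a * dotv x y.
Proof. by rewrite mulr_sumr; apply: eq_bigr => i _; rewrite mxE mulrA. Qed.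

Lemma dotvNl x y : dotv (- x) y = - dotv x y.
Proof. by rewrite -scaleN1r dotvZl mulN1r. Qed.

Lemma dotvBr x y z : dotv x (y - z) = dotv x y - dotv x z.
Proof. by rewrite dotvC dotvDl dotvNl dotvC [dotv z x]dotvC. Qed.

Lemma dotv0 x : dotv x 0 = 0.
Proof. by apply: big1 => i _; rewrite mxE mulr0. Qed.

Lemma dotvv_ge0 x : 0 <= dotv x x.
Proof. by apply: sumr_ge0 => i _; rewrite -expr2 sqr_ge0. Qed.

Lemma dotvv_eq0 x : dotv x x = 0 -> x = 0.
Proof.
move=> /eqP; rewrite psumr_eq0 => [/allP x0|i _]; last by rewrite -expr2 sqr_ge0.
apply/rowP => i; rewrite mxE; apply/eqP.
by have := x0 i (mem_index_enum _); rewrite -expr2 sqrf_eq0.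
Qed.

Lemma cauchy_schwarz_dotv x y : `|dotv x y| <= enorm x * enorm y.
Proof.
rewrite -sqrtrM ?dotvv_ge0// -sqrtr_sqr; apply: ler_wsqrtr.
have [x0|x0] := eqVneq (dotv x x) 0.
  by rewrite x0 (dotvv_eq0 x0) dotvC dotv0 expr0n mul0r.
have xgt0 : 0 < dotv x x by rewrite lt_def x0 dotvv_ge0.
(* This square norm expands to |x|^2 (|x|^2 |y|^2 - (x.y)^2). *)
have := dotvv_ge0 (dotv x x *: y - dotv x y *: x).
rewrite dotvBr !(dotvC (_ - _)) !dotvBr !dotvZl !(dotvC _ (_ *: _)) !dotvZl.
rewrite (dotvC y x) => H.
rewrite -(ler_pM2l xgt0).
by move: H; lra.
Qed.

Lemma enorm0 : enorm (0 : 'rV[R]_d) = 0.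
Proof. by rewrite /enorm dotv0 sqrtr0. Qed.

Lemma enorm_ge0 x : 0 <= enorm x.
Proof. exact: sqrtr_ge0. Qed.

Lemma enormN x : enorm (- x) = enorm x.
Proof. by rewrite /enorm dotvNl dotvC dotvNl opprK. Qed.

Lemma sphereP x : sphere x <-> dotv x x = 1.
Proof.
rewrite /sphere /= /enorm; split => [h|->]; last exact: sqrtr1.
by rewrite -(sqr_sqrtr (dotvv_ge0 x)) h expr1n.
Qed.

Lemma measurable_fun_Rd (f : 'rV[R]_d -> R) :
  continuous f -> measurable_fun [set: Rd R d] f.
Proof.
move=> cf; apply: (measurability _ (RGenOpens.measurableE R)).
move=> _ [_ [a [b ->]] <-]; rewrite setTI; apply: sub_gen_smallest.
by apply: open_comp => //; exact: interval_open.
Qed.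

Lemma dotv_continuous (f g : 'rV[R]_d -> 'rV[R]_d) :
  continuous f -> continuous g -> continuous (fun x => dotv (f x) (g x)).
Proof.
move=> cf cg; have coord (h : 'rV[R]_d -> 'rV[R]_d) (i : 'I_d) :
    continuous h -> continuous (fun x => h x 0 i).
  move=> ch x; apply: (@continuous_comp _ _ _ h (fun v : 'rV[R]_d => v 0 i)).
    exact: ch.
  exact: coord_continuous.
apply: continuous_big => [|i _ x]; first exact: add_continuous.
exact: (cvgM (coord f i cf x) (coord g i cg x)).
Qed.

Lemma dotvr_continuous y : continuous (fun x => dotv x y).
Proof.
apply: (@dotv_continuous id (cst y)); first by move=> ?; exact: cvg_id.
exact: cst_continuous.
Qed.

Lemma enorm_continuous : continuous (@enorm R d).
Proof.
move=> x; apply: (continuous_comp (f := fun x => dotv x x) (g := Num.sqrt)).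
  by apply: (@dotv_continuous id id) => ?; exact: cvg_id.
exact: sqrt_continuous.
Qed.

Lemma measurable_dotv y : measurable_fun [set: Rd R d] (fun x => dotv x y).
Proof. apply: measurable_fun_Rd; exact: dotvr_continuous. Qed.

Lemma measurable_enorm : measurable_fun [set: Rd R d] (@enorm R d).
Proof. apply: measurable_fun_Rd; exact: enorm_continuous. Qed.

Lemma measurable_sphere : measurable (@sphere R d : set (Rd R d)).
Proof.
rewrite -[X in measurable X]setTI.
by apply: (measurable_enorm _ (measurable_set1 1)).
Qed.

End euclidean.

(** * Lipschitz dependence of the projected distance on the direction *)

Section sliced_wasserstein.
Local Open Scope ereal_scope.
Context (R : realType) (d : nat) (p : R).
Hypothesis p1 : (1 <= p)%R.
Implicit Types mu nu eta : probability (Rd R d) R.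

Let p0 : (0 < p)%R. Proof. exact: lt_le_trans p1. Qed.

Lemma Wpp_sym (a b : set R -> \bar R) : Wpp p a b = Wpp p b a.
Proof.
suff le a' b' : Wpp p a' b' <= Wpp p b' a' by apply/eqP; rewrite eq_le !le.
apply: le_ereal_inf_tmp => _ [pi ba <-].
have mswap : measurable_fun setT (fun z : R * R => (z.2, z.1)).
  by apply: measurable_fun_pair; [exact: measurable_snd|exact: measurable_fst].
have [pi' pi'E] := pushforward_probability pi mswap.
apply: (@le_trans _ _ (\int[pi']_z (`|z.1 - z.2| `^ p)%:E)).
  by apply: Wpp_le => A mA; rewrite !pi'E; have [<- <-] := ba _ mA.
rewrite (eq_measure_integral (pushforward pi (fun z : R * R => (z.2, z.1)))); last first.
  by move=> A mA _; exact: pi'E.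
rewrite ge0_integral_pushforward//=; last first.
  apply: measurable_powR_normr; apply: measurable_funB.
    exact: measurable_fst.
  exact: measurable_snd.
by under eq_integral do rewrite distrC.
Qed.

(** The distance itself, not its p-th power, and for directions in all of R^d: this is the Lipschitz
    function, defined on the space that carries every sigma. *)
Definition slicedW mu nu (t : 'rV[R]_d) : \bar R :=
  Wpp p (radon mu t) (radon nu t) `^ p^-1.

Definition momentN mu : \bar R := 'N[mu]_p%:E[EFin \o @enorm R d].

(** The law of (x.t, x.t') under [mu] is a coupling, whose cost Cauchy-Schwarz bounds. With [mu] =
    [nu] this gives the Lipschitz estimate; with t = t' it gives distance 0 between measures that
    agree on Borel sets. *)
Lemma radon_Wpp_le mu nu (t t' : 'rV[R]_d) :
  (forall A : set (Rd R d), measurable A -> mu A = nu A) ->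
  Wpp p (radon mu t) (radon nu t') `^ p^-1 <= (enorm (t - t'))%:E * momentN mu.
Proof.
move=> munu.
have mh : measurable_fun [set: Rd R d] (fun x => (dotv x t, dotv x t')).
  by apply: measurable_fun_pair; exact: measurable_dotv.
have [pi piE] := pushforward_probability mu mh.
have mdiff : measurable_fun setT (fun z : R * R => z.1 - z.2)%R.
  by apply: measurable_funB; [exact: measurable_fst|exact: measurable_snd].
have cpl : coupling (radon mu t) (radon nu t') pi.
  move=> A mA; rewrite !piE /radon; split => //.
  apply: munu; rewrite -[X in measurable X]setTI.
  exact: measurable_dotv.
apply: (@le_trans _ _ 'N[pi]_p%:E[EFin \o (fun z => z.1 - z.2)%R]).
  rewrite LnormEFinE; apply: gt0_ler_poweR.
  - by rewrite invr_ge0 ltW.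
  - by rewrite in_itv/= leey Wpp_ge0.
  - rewrite in_itv/= leey andbT; apply: integral_ge0 => z _.
    by rewrite lee_fin powR_ge0.
  - exact: Wpp_le.
rewrite (Lnorm_pushforward p mh mdiff (m := mu)); last by move=> A _; exact: piE.
rewrite /momentN !LnormEFinE.
have M0 : 0 <= \int[mu]_x (`|enorm x| `^ p)%:E.
  by apply: integral_ge0 => x _; rewrite lee_fin powR_ge0.
have -> : (enorm (t - t'))%:E = (enorm (t - t') `^ p)%:E `^ p^-1 :> \bar R.
  by rewrite poweR_EFin -powRrM mulfV ?gt_eqF// powRr1// enorm_ge0.
rewrite -poweRM ?lee_fin ?powR_ge0//.
apply: gt0_ler_poweR.
- by rewrite invr_ge0 ltW.
- rewrite in_itv/= leey andbT; apply: integral_ge0 => z _.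
  by rewrite lee_fin powR_ge0.
- by rewrite in_itv/= leey andbT mule_ge0// lee_fin powR_ge0.
rewrite -ge0_integralZl//; last 2 first.
- apply: measurable_powR_normr; exact: measurable_enorm.
- by rewrite lee_fin powR_ge0.
apply: ge0_le_integral => //.
- apply: measurable_powR_normr.
  by apply: measurable_funB; exact: measurable_dotv.
- apply: emeasurable_funM; first exact: measurable_cst.
  apply: measurable_powR_normr; exact: measurable_enorm.
move=> x _ /=; rewrite -dotvBr -EFinM lee_fin.
rewrite (ger0_norm (enorm_ge0 x)) -powRM ?enorm_ge0//.
apply: ge0_ler_powR; rewrite ?nnegrE ?mulr_ge0 ?enorm_ge0//; first exact: ltW.
by rewrite mulrC cauchy_schwarz_dotv.
Qed.

Lemma momentN_fin mu : mu \in Pp d p -> momentN mu \is a fin_num.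
Proof.
rewrite inE /Pp /= => mup; rewrite /momentN ge0_fin_numE ?Lnorm_ge0//.
rewrite LnormEFinE; apply: poweR_lty; apply: le_lt_trans mup.
by under eq_integral do rewrite ger0_norm ?enorm_ge0//.
Qed.

Lemma slicedW_ge0 mu nu t : 0 <= slicedW mu nu t.
Proof. exact: poweR_ge0. Qed.

(** Both sides are the Dirac mass at 0, the intermediate measure through which [slicedW_le] compares
    [mu] with [nu]. *)
Lemma radon0 mu nu : radon mu 0 = radon nu 0.
Proof.
apply/funext => A; rewrite /radon.
have [A0|A0] := pselect (A 0%R).
  rewrite (_ : _ @^-1` _ = setT).
    by rewrite (probability_setT mu) (probability_setT nu).
  by apply/seteqP; split => // x _ /=; rewrite dotv0.
rewrite (_ : _ @^-1` _ = set0); first by rewrite !measure0.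
by rewrite -subset0 => x /=; rewrite dotv0.
Qed.

Lemma slicedW_le mu nu t :
  slicedW mu nu t <= (enorm t)%:E * (momentN mu + momentN nu).
Proof.
apply: (le_trans (Wpp_triangle _ (radon mu 0) _ p1)).
rewrite ge0_muleDr ?Lnorm_ge0//; apply: leeD.
  by have := @radon_Wpp_le mu mu t 0 (fun _ _ => erefl); rewrite subr0.
rewrite (radon0 mu nu).
by have := @radon_Wpp_le nu nu 0 t (fun _ _ => erefl); rewrite sub0r enormN.
Qed.

Lemma slicedW_lipschitz mu nu t t' :
  slicedW mu nu t <= slicedW mu nu t' +
    (enorm (t - t'))%:E * (momentN mu + momentN nu).
Proof.
apply: (le_trans (Wpp_triangle _ (radon mu t') _ p1)).
rewrite ge0_muleDr ?Lnorm_ge0// addeCA; apply: leeD.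
  exact: radon_Wpp_le.
apply: (le_trans (Wpp_triangle _ (radon nu t') _ p1)).
apply: leeD => //; rewrite -enormN opprB.
exact: radon_Wpp_le.
Qed.

Lemma slicedW_fin mu nu t : mu \in Pp d p -> nu \in Pp d p ->
  slicedW mu nu t \is a fin_num.
Proof.
move=> mup nup; rewrite ge0_fin_numE ?slicedW_ge0//.
apply: (le_lt_trans (slicedW_le _ _ _)).
by rewrite ltey_eq fin_numM// fin_numD !momentN_fin.
Qed.

Lemma fine_slicedW_continuous mu nu : mu \in Pp d p -> nu \in Pp d p ->
  continuous (fun t => fine (slicedW mu nu t)).
Proof.
move=> mup nup t.
have [M ME] : exists M, momentN mu + momentN nu = M%:E.
  by exists (fine (momentN mu + momentN nu)); rewrite fineK// fin_numD !momentN_fin.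
have lip u v : (fine (slicedW mu nu u) <=
    fine (slicedW mu nu v) + enorm (u - v) * M)%R.
  rewrite -lee_fin EFinD EFinM !fineK ?slicedW_fin// -ME.
  exact: slicedW_lipschitz.
apply/(@cvgrPdist_le _ _ _ _ (nbhs_filter t)) => e e0.
have M0 : (0 < `|M| + 1)%R by rewrite ltr_wpDl.
have cn : (fun u => enorm (t - u)) @ t --> (0 : R)%R.
  rewrite -(enorm0 R d) -(subrr t).
  apply: (@cvg_comp _ _ _ (fun u => t - u)%R (@enorm R d)); last exact: enorm_continuous.
  exact: (@cvgB _ _ _ _ (nbhs_filter t) (cst t) id _ _ (@cvg_cst _ _ _ _ _) (@cvg_id _ _)).
move/(@cvgrPdist_le _ _ _ _ (nbhs_filter t)) : cn => /(_ (e / (`|M| + 1))%R).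
rewrite divr_gt0// => /(_ isT); apply: filterS => u.
rewrite sub0r normrN (ger0_norm (enorm_ge0 _)) ler_pdivlMr// => tu.
have tu' : (enorm (t - u) * M <= e)%R.
  apply: le_trans tu; apply: ler_wpM2l; first exact: enorm_ge0.
  by rewrite (le_trans (ler_norm _))// lerDl.
rewrite ler_norml; apply/andP; split.
  have := lip u t; rewrite -enormN opprB; lra.
by have := lip t u; lra.
Qed.

Lemma measurable_fine_slicedW mu nu : mu \in Pp d p -> nu \in Pp d p ->
  measurable_fun [set: Rd R d] (fun t => fine (slicedW mu nu t)).
Proof. by move=> mup nup; apply: measurable_fun_Rd; exact: fine_slicedW_continuous. Qed.

(** Turns the quantity under the supremum of [DSW] into an L^p(s) norm of a real function, the form
    in which Minkowski applies. *)
Lemma integral_Wpp_radon mu nu (s : probability (Rd R d) R) :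
  mu \in Pp d p -> nu \in Pp d p ->
  (\int[s]_t Wpp p (radon mu t) (radon nu t)) `^ p^-1 =
  'N[s]_p%:E[EFin \o (fun t => fine (slicedW mu nu t))].
Proof.
move=> mup nup; rewrite LnormEFinE; congr (_ `^ _); apply: eq_integral => t _.
rewrite ger0_norm ?fine_ge0 ?slicedW_ge0// -poweR_EFin fineK ?slicedW_fin//.
by rewrite /slicedW -poweRrM mulVf ?gt_eqF// poweRe1// Wpp_ge0.
Qed.

End sliced_wasserstein.

(** * Measures at zero distance *)

Section zero_distance.
Local Open Scope ereal_scope.
Context (R : realType).

Lemma bounded_integrable d (T : measurableType d) (m : probability T R)
    (f : T -> R) (B : R) : measurable_fun setT f -> (forall x, (`|f x| <= B)%R) ->
  m.-integrable setT (EFin \o f).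
Proof.
move=> mf fB; apply: measurable_bounded_integrable => //.
  by rewrite (le_lt_trans (probability_le1 m _))// ltey.
exists B; split; first exact: num_real.
by move=> r Br x _ /=; exact: le_trans (fB x) (ltW Br).
Qed.

(** If r > e then r / e >= 1 is at most its p-th power. It bounds a mean distance by e plus a
    multiple of the p-th power cost. *)
Lemma le_powR_split (p e r : R) : (1 <= p)%R -> (0 < e)%R -> (0 <= r)%R ->
  (r <= e + e * e^-1 `^ p * r `^ p)%R.
Proof.
move=> p1 e0 r0; have [re|er] := leP r e.
  by rewrite (le_trans re)// lerDl !mulr_ge0 ?powR_ge0// ltW.
apply: (@le_trans _ _ (e * e^-1 `^ p * r `^ p)%R); last by rewrite lerDr ltW.
rewrite -mulrA -powRM ?invr_ge0 ?(ltW e0)//.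
rewrite -[leLHS](mulVKf (lt0r_neq0 e0)) ler_pM2l//.
have er1 : (1 <= e^-1 * r)%R by rewrite ler_pdivlMl// mulr1 ltW.
by rewrite -[leLHS]powRr1 ?(le_trans _ er1)// ler_powR.
Qed.

(** Couplings of arbitrarily small cost exist, and under such a coupling the mean of |phi x - phi y|
    is small by the Lipschitz bound and [le_powR_split]. *)
Lemma Wpp_eq0_integral (p : R) (P Q : probability R R) (phi : R -> R) (L B : R) :
  (1 <= p)%R -> (0 <= L)%R -> measurable_fun setT phi ->
  (forall x y, `|phi x - phi y| <= L * `|x - y|)%R ->
  (forall x, `|phi x| <= B)%R -> Wpp p P Q = 0 ->
  \int[P]_x (phi x)%:E = \int[Q]_x (phi x)%:E.
Proof.
move=> p1 L0 mphi lip phiB W0.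
have intf (m : probability R R) : m.-integrable setT (EFin \o phi).
  exact: bounded_integrable phiB.
have fin (m : probability R R) : \int[m]_x (phi x)%:E \is a fin_num.
  exact: (integrable_fin_num measurableT (intf m)).
suff H : (`|fine (\int[P]_x (phi x)%:E) - fine (\int[Q]_x (phi x)%:E)| <= 0)%R.
  by rewrite -(fineK (fin P)) -(fineK (fin Q)); move: H; rewrite normr_le0 subr_eq0 => /eqP ->.
apply/ler_addgt0Pr => e0 e0gt0; rewrite add0r.
(* The estimate ends at (L + L) e; the extra 1 keeps the divisor positive when L = 0. *)
have L1 : (0 < L + L + 1)%R by rewrite ltr_wpDl// addr_ge0.
pose e := (e0 / (L + L + 1))%R.
have egt0 : (0 < e)%R by rewrite divr_gt0.
pose K := (e * e^-1 `^ p)%R.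
have K0 : (0 < K)%R by rewrite mulr_gt0// powR_gt0// invr_gt0.
(* K is the coefficient in [le_powR_split], so a cost below e / K contributes at most L e, as much
   as the constant term. *)
have : Wpp p P Q < (e / K)%:E by rewrite W0 lte_fin divr_gt0.
move=> /ereal_inf_lt[_ [pi PQ <-] cost].
have mfst : measurable_fun setT (fun z : R * R => phi z.1).
  by apply: (measurableT_comp mphi); exact: measurable_fst.
have msnd : measurable_fun setT (fun z : R * R => phi z.2).
  by apply: (measurableT_comp mphi); exact: measurable_snd.
have ifst : pi.-integrable setT (EFin \o (fun z : R * R => phi z.1)).
  by apply: (@bounded_integrable _ _ _ _ B).
have isnd : pi.-integrable setT (EFin \o (fun z : R * R => phi z.2)).
  by apply: (@bounded_integrable _ _ _ _ B).
have EP : \int[P]_x (phi x)%:E = \int[pi]_z (phi z.1)%:E.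
  rewrite (eq_measure_integral (pushforward pi (fst : R * R -> R))).
    by rewrite integral_pushforward//; exact/measurable_EFinP.
  by move=> A mA _; exact: (esym (PQ _ mA).1).
have EQ : \int[Q]_x (phi x)%:E = \int[pi]_z (phi z.2)%:E.
  rewrite (eq_measure_integral (pushforward pi (snd : R * R -> R))).
    by rewrite integral_pushforward//; exact/measurable_EFinP.
  by move=> A mA _; exact: (esym (PQ _ mA).2).
rewrite -lee_fin -abse_EFin EFinB !fineK// EP EQ -integralB_EFin//.
apply: (le_trans (le_abse_integral _ _ _)) => //.
  by apply/measurable_EFinP; exact: measurable_funB.
have mcost : measurable_fun setT (fun z : R * R => (`|z.1 - z.2| `^ p)%:E : \bar R).
  apply: measurable_powR_normr.
  by apply: measurable_funB; [exact: measurable_fst|exact: measurable_snd].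
apply: (@le_trans _ _ (\int[pi]_z ((L * e)%:E + (L * K)%:E * (`|z.1 - z.2| `^ p)%:E))).
  apply: ge0_le_integral => //.
  - apply: measurableT_comp => //; apply/measurable_EFinP.
    exact: measurable_funB.
  - apply: emeasurable_funD => //; apply: emeasurable_funM => //.
  - move=> z _; rewrite -EFinB abse_EFin lee_fin.
    apply: (le_trans (lip _ _)); rewrite -mulrA -mulrDr ler_wpM2l//.
    exact: le_powR_split.
have e_ge0 := ltW egt0; have K_ge0 := ltW K0.
rewrite ge0_integralD//; last 3 first.
- by move=> z _; rewrite lee_fin; exact: mulr_ge0.
- by move=> z _; apply: mule_ge0; rewrite lee_fin; [exact: mulr_ge0|exact: powR_ge0].
- by apply: emeasurable_funM.
rewrite ge0_integralZl//; last by rewrite lee_fin; exact: mulr_ge0.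
rewrite integral_cst// [X in _ * X + _](_ : _ = 1); last exact: probability_setT.
rewrite mule1; apply: (@le_trans _ _ ((L * e)%:E + (L * K)%:E * (e / K)%:E)).
  have LK0 : (0 <= L * K)%R by exact: mulr_ge0.
  by rewrite leeD2l// lee_wpmul2l// ltW.
rewrite -EFinM -EFinD lee_fin.
rewrite (_ : L * K * (e / K) = L * e)%R; last by field; rewrite gt_eqF.
rewrite -mulrDl {1}/e mulrCA ler_piMr ?(ltW e0gt0)// ler_pdivrMr// mul1r.
by rewrite lerDl.
Qed.

Lemma cos_lipschitz (x y : R) : (`|cos x - cos y| <= `|x - y|)%R.
Proof.
wlog xy : x y / (y <= x)%R.
  move=> H; have [/H//|/ltW/H] := leP y x.
  by rewrite (distrC (cos x)) (distrC x).
have [|c _ ->] := @MVT_segment R cos (fun x => - sin x)%R y x xy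
    (fun z _ => is_derive_cos z).
  by apply: continuous_subspaceT => z; exact: continuous_cos.
rewrite normrM normrN ler_piMl//.
exact: sin_max.
Qed.

End zero_distance.

(** * The Cramer-Wold theorem *)

Section orthants.
Context (R : realType) (d : nat).

Definition orthant (a : 'rV[R]_d) : set 'rV[R]_d :=
  [set x | forall i, x 0 i < a 0 i].

Let T := g_sigma_algebraType (range orthant).

(** Let the bounds on all coordinates but the i-th go to infinity. *)
Let measurable_halfspace i c : measurable ([set x | x 0 i < c] : set T).
Proof.
pose a n : 'rV[R]_d := \row_j (if j == i then c else n%:R).
rewrite [X in measurable X](_ : _ = \bigcup_n (orthant (a n))); last first.
  apply/seteqP; split => [x /= xc|x [n _ /(_ i)]]; last by rewrite mxE eqxx.
  exists (Num.truncn (\sum_j `|x 0 j|)).+1 => // j; rewrite mxE.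
  case: eqVneq => [->//|_]; apply: le_lt_trans (truncnS_gt _).
  rewrite (le_trans (ler_norm _))// (bigD1 j)//= lerDl.
  by apply: sumr_ge0.
by apply: bigcupT_measurable => n; apply: sub_gen_smallest; exists (a n).
Qed.

(** Cubes with rational centre [k.1] and half-side [k.2], countably many. They are half-open because
    the lower faces come from complements of open half-spaces. *)
Let box (k : 'rV[rat]_d * rat) : set 'rV[R]_d :=
  [set y | forall i, ratr (k.1 0 i - k.2) <= y 0 i < ratr (k.1 0 i + k.2)].

Let measurable_box k : measurable (box k : set T).
Proof.
rewrite (_ : box k = \bigcap_(i in [set: 'I_d])
   ([set x | x 0 i < ratr (k.1 0 i + k.2)] `&`
    ~` [set x | x 0 i < ratr (k.1 0 i - k.2)])).
  apply: (@fin_bigcap_measurable _ T) => [|i _]; first exact: finite_finset.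
  apply: measurableI; first exact: measurable_halfspace.
  by apply: measurableC; exact: measurable_halfspace.
apply/seteqP; split => [y yk i _|y yk i].
  by have /andP[lo hi] := yk i; split => //=; apply/negP; rewrite -leNgt.
by have [hi /negP] := yk i I; rewrite -leNgt /= => ->.
Qed.

(** An open set is the union of the rational boxes inside it; boxes that do not fit are replaced by
    the empty set to keep the countable index type. *)
Lemma open_sigma_orthant (U : set 'rV[R]_d) :
  open U -> <<s range orthant >> U.
Proof.
move=> oU; change (measurable (U : set T)).
rewrite (_ : U = \bigcup_k (if pselect (box k `<=` U) then box k else set0)).
  apply: countable_bigcupT_measurable; first exact: countableP.
  by move=> k; case: pselect => /= _; [exact: measurable_box|exact: measurable0].
apply/seteqP; split => [x Ux|x [k _]]; last by case: pselect => // kU /= /kU.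
have /nbhs_ballP[e /= e0 xeU] : nbhs x U by exact: open_nbhs_nbhs.
(* The centre will be within r of x in each coordinate, so the points of the box are within 2 r < e
   of x in the sup norm. *)
have [r] := @rat_in_itvoo R 0 (e / 2) (divr_gt0 e0 (ltr0n _ 2)).
rewrite in_itv /= => /andP[r0 re].
have q_ex i : exists q : rat, ratr q \in `]x 0 i - ratr r, x 0 i + ratr r[.
  by apply: rat_in_itvoo; rewrite ltrBlDr -addrA ltrDl addr_gt0.
have [q qP] := choice q_ex.
exists (\row_i q i, r) => //; case: pselect => /= [_ i|]; last first.
  case; move=> y yb; apply: xeU; split => // i j; rewrite ord1.
  have := yb j; rewrite /= mxE rmorphB rmorphD/= => /andP[lo hi].
  have := qP j; rewrite in_itv/= => /andP[qlo qhi].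
  by rewrite /ball /= ltr_norml; apply/andP; split; lra.
have := qP i; rewrite in_itv/= => /andP[qlo qhi]; rewrite /= mxE rmorphB rmorphD/=.
by apply/andP; split; lra.
Qed.

Lemma orthantI a b : exists c, orthant a `&` orthant b = orthant c.
Proof.
exists (\row_i Num.min (a 0 i) (b 0 i)); apply/seteqP; split => x.
  by move=> [xa xb] i; rewrite mxE lt_min xa xb.
by move=> xc; split => i; have := xc i; rewrite mxE lt_min => /andP[].
Qed.

Lemma measurable_orthant a : measurable (orthant a : set (Rd R d)).
Proof.
rewrite (_ : orthant a = \bigcap_(i in [set: 'I_d])
    ((fun x : 'rV[R]_d => x 0 i) @^-1` `]-oo, a 0 i[)).
  apply: (@fin_bigcap_measurable _ (Rd R d)) => [|i _]; first exact: finite_finset.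
  rewrite -[X in measurable X]setTI.
  apply: (@measurable_fun_Rd R d (fun x => x 0 i)) => //.
  exact: coord_continuous.
apply/seteqP; split => [x xa i _ /=|x xa i]; first by rewrite in_itv/=.
by have := xa i I; rewrite /= in_itv.
Qed.

(** Uniqueness of measures on a pi-system: orthants are stable under intersection, cover the space
    and generate its Borel sets. *)
Lemma eq_measure_orthant (mu nu : probability (Rd R d) R) :
  (forall a, mu (orthant a) = nu (orthant a)) ->
  forall A, measurable A -> mu A = nu A.
Proof.
move=> munu A mA.
apply: (@g_sigma_algebra_measure_unique _ R (Rd R d) (range orthant) _
  (fun n => orthant (const_mx n%:R))).
- by move=> _ [a _ <-]; exact: measurable_orthant.
- by move=> n; exists (const_mx n%:R).
- rewrite -subTset => x _.
  exists (Num.truncn (\sum_j `|x 0 j|)).+1 => // j; rewrite mxE.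
  apply: le_lt_trans (truncnS_gt _).
  rewrite (le_trans (ler_norm _))// (bigD1 j)//= lerDl.
  by apply: sumr_ge0.
- move=> _ _ [a _ <-] [b _ <-]; have [c ->] := orthantI a b.
  by exists c.
- by move=> _ [a _ <-]; exact: munu.
- by move=> k; rewrite (le_lt_trans (probability_le1 mu _)) ?ltey//; exact: measurable_orthant.
suff sub : <<s @open 'rV[R]_d >> `<=` <<s range orthant >> by exact: sub.
apply: smallest_sub; first exact: smallest_sigma_algebra.
by move=> U oU; exact: open_sigma_orthant.
Qed.

End orthants.

(** * Polynomials approximating a step at 1/2 *)

Section step_polynomials.
Context (R : realType).

Lemma bernoulli_inequality (x : R) n : -1 <= x -> 1 + n%:R * x <= (1 + x) ^+ n.
Proof.
move=> x1; elim: n => [|n IH]; first by rewrite mul0r addr0 expr0.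
rewrite exprS; apply: (@le_trans _ _ ((1 + x) * (1 + n%:R * x))).
  rewrite -natr1 -subr_ge0 (_ : _ - _ = n%:R * x ^+ 2); last by ring.
  by rewrite mulr_ge0// sqr_ge0.
by apply: ler_wpM2l => //; rewrite -lerBlDl sub0r.
Qed.

Lemma cvg_natM_geometric (r : R) : 0 <= r < 1 -> n%:R * r ^+ n @[n --> \oo] --> 0.
Proof.
(* By the inequality of means r <= rho^2. One factor rho^n absorbs n, by Bernoulli for 1 / rho = 1 +
   h, and the other still tends to 0. *)
move=> /andP[r0 r1]; pose rho := (1 + r) / 2.
have rho0 : 0 < rho by rewrite /rho; lra.
have rho1 : rho < 1 by rewrite /rho; lra.
have rrho : r <= rho * rho by rewrite /rho; nra.
pose h := rho^-1 - 1.
have h0 : 0 < h by rewrite subr_gt0 invf_gt1.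
have nrho n : n%:R * rho ^+ n <= h^-1.
  have hn : n%:R * h <= rho^-1 ^+ n.
    rewrite (_ : rho^-1 = 1 + h); last by rewrite addrC subrK.
    apply: le_trans (@bernoulli_inequality h n _); first by rewrite lerDr.
    by rewrite (le_trans _ (ltW h0))// lerN10.
  rewrite -[leRHS]mul1r ler_pdivlMr// mulrAC.
  by rewrite -ler_pdivlMr ?exprn_gt0// div1r -exprVn.
apply: (@squeeze_cvgr _ _ _ _ (cst 0) (fun n => h^-1 * rho ^+ n)).
- near=> n; rewrite mulr_ge0 ?exprn_ge0//=.
  apply: (@le_trans _ _ (n%:R * (rho * rho) ^+ n)).
    by rewrite ler_wpM2l// lerXn2r// nnegrE// mulr_ge0// ltW.
  by rewrite exprMn mulrA ler_wpM2r ?exprn_ge0// ltW.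
- exact: cvg_cst.
rewrite -[X in _ --> X](mulr0 h^-1); apply: cvgM; first exact: cvg_cst.
by apply: cvg_expr; rewrite ger0_norm// ltW.
Unshelve. all: by end_near. Qed.

(** The exponent N = n 2^n makes N s^n = n (2s)^n, which tends to 0 for s < 1/2 and is at least n
    from 1/2 on. The factor n settles s = 1/2, where the limit must be 0 to match the strict
    inequalities of [orthant]. *)
Definition step_poly (n : nat) (s : R) : R := (1 - s ^+ n) ^+ (n * 2 ^ n).

Lemma step_poly_itv n (s : R) : 0 <= s <= 1 -> 0 <= step_poly n s <= 1.
Proof.
move=> /andP[s0 s1]; have sn0 : 0 <= s ^+ n by rewrite exprn_ge0.
have sn1 : s ^+ n <= 1 by rewrite exprn_ile1.
by rewrite exprn_ge0 ?subr_ge0// exprn_ile1 ?subr_ge0// gerBl.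
Qed.

Lemma cvg_step_poly (s : R) : 0 <= s <= 1 ->
  step_poly n s @[n --> \oo] --> ((s < 2^-1)%R%:R : R).
Proof.
move=> s01; have /andP[s0 s1] := s01.
have sn0 n : 0 <= s ^+ n by rewrite exprn_ge0.
have sn1 n : s ^+ n <= 1 by rewrite exprn_ile1.
have NE n : (n * 2 ^ n)%:R * s ^+ n = n%:R * (2 * s) ^+ n.
  by rewrite natrM natrX exprMn mulrA.
case: ltP => [s2|s2] /=.
  apply: (@squeeze_cvgr _ _ _ _ (fun n => 1 - n%:R * (2 * s) ^+ n) (cst 1)).
  - near=> n; have /andP[_ ->] := step_poly_itv n s01; rewrite andbT.
    rewrite -NE -mulrN; apply: bernoulli_inequality.
    by rewrite lerN2.
  - rewrite -[X in _ --> X]subr0; apply: cvgB; first exact: cvg_cst.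
    by apply: cvg_natM_geometric; apply/andP; split; lra.
  - exact: cvg_cst.
apply: (@squeeze_cvgr _ _ _ _ (cst 0) (fun n => n.+1%:R^-1)).
- near=> n; have /andP[-> _] := step_poly_itv n s01; rewrite andTb.
  rewrite -[leRHS]mul1r ler_pdivlMr ?ltr0n//.
  (* With u = s^n and N the exponent, (1 - u)^N (1 + u)^N = (1 - u^2)^N <= 1, while (1 + u)^N >= n +
     1; hence the bound 1 / (n + 1). *)
  have B : n.+1%:R <= (1 + s ^+ n) ^+ (n * 2 ^ n).
    apply: (@le_trans _ _ (1 + (n * 2 ^ n)%:R * s ^+ n)).
      rewrite NE -natr1 addrC lerD2l -[leLHS]mulr1 ler_wpM2l//.
      by rewrite exprn_ege1//; lra.
    by apply: bernoulli_inequality; rewrite (le_trans _ (sn0 n))// lerN10.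
  apply: (@le_trans _ _ (step_poly n s * (1 + s ^+ n) ^+ (n * 2 ^ n))).
    by rewrite ler_wpM2l//; have /andP[] := step_poly_itv n s01.
  rewrite -exprMn exprn_ile1//; first by rewrite mulr_ge0 ?subr_ge0// addr_ge0.
  by rewrite (_ : _ * _ = 1 - (s ^+ n) ^+ 2) ?gerBl ?sqr_ge0//; ring.
- exact: cvg_cst.
exact: cvg_harmonic.
Unshelve. all: by end_near. Qed.

End step_polynomials.

(** * Cosine integrals determine the measure *)

Section cramer_wold.
Context (R : realType) (d : nat).
Implicit Types f g : 'rV[R]_d -> R.

(** The linear span of the cosines only, so that equal integrals extend by linearity; the phase b
    covers sines and constants, and closure under products is derived. *)
Inductive trigpoly : ('rV[R]_d -> R) -> Prop :=
| trigpoly_cos u b : trigpoly (fun x => cos (dotv x u + b))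
| trigpolyD f g : trigpoly f -> trigpoly g -> trigpoly (fun x => f x + g x)
| trigpolyZ c f : trigpoly f -> trigpoly (fun x => c * f x).

Lemma eq_trigpoly f g : f =1 g -> trigpoly f -> trigpoly g.
Proof. by move=> /funext ->. Qed.

Lemma trigpoly_cst c : trigpoly (fun=> c).
Proof.
apply: eq_trigpoly (trigpolyZ c (trigpoly_cos 0 0)) => x.
by rewrite dotv0 addr0 cos0 mulr1.
Qed.

(** On generators this is cos A cos B = (cos (A + B) + cos (A - B)) / 2. *)
Lemma trigpolyM f g : trigpoly f -> trigpoly g -> trigpoly (fun x => f x * g x).
Proof.
move=> tf tg; elim: tf => {f} [u b|f f' _ IH _ IH'|c f _ IH].
- elim: tg => {g} [v c|g g' _ IH _ IH'|c g _ IH].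
  + apply: eq_trigpoly (trigpolyD (trigpolyZ 2^-1 (trigpoly_cos (u + v) (b + c)))
      (trigpolyZ 2^-1 (trigpoly_cos (u - v) (b - c)))) => x.
    rewrite dotvBr (dotvC x (u + v)) dotvDl !(dotvC _ x).
    rewrite (_ : dotv x u + dotv x v + (b + c) = (dotv x u + b) + (dotv x v + c)); last by ring.
    rewrite (_ : dotv x u - dotv x v + (b - c) = (dotv x u + b) - (dotv x v + c)); last by ring.
    by rewrite cosD cosB; field.
  + by apply: eq_trigpoly (trigpolyD IH IH') => x; rewrite mulrDr.
  + by apply: eq_trigpoly (trigpolyZ c IH) => x; rewrite mulrCA.
- by apply: eq_trigpoly (trigpolyD IH IH') => x; rewrite mulrDl.
- by apply: eq_trigpoly (trigpolyZ c IH) => x; rewrite mulrA.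
Qed.

Lemma trigpolyX f n : trigpoly f -> trigpoly (fun x => f x ^+ n).
Proof.
move=> tf; elim: n => [|n IH]; first exact: trigpoly_cst.
by apply: eq_trigpoly (trigpolyM tf IH) => x; rewrite exprS.
Qed.

Lemma trigpoly_prod (I : Type) (r : seq I) (F : I -> 'rV[R]_d -> R) :
  (forall i, trigpoly (F i)) -> trigpoly (fun x => \prod_(i <- r) F i x).
Proof.
move=> tF; elim: r => [|i r IH].
  by apply: eq_trigpoly (trigpoly_cst 1) => x; rewrite big_nil.
by apply: eq_trigpoly (trigpolyM (tF i) IH) => x; rewrite big_cons.
Qed.

Lemma trigpoly_step n f : trigpoly f -> trigpoly (fun x => step_poly n (f x)).
Proof.
move=> tf; apply: trigpolyX.
apply: eq_trigpoly (trigpolyD (trigpoly_cst 1) (trigpolyZ (-1) (trigpolyX n tf))).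
by move=> x; rewrite mulN1r.
Qed.

Lemma trigpoly_continuous f : trigpoly f -> continuous f.
Proof.
elim=> {f} [u b|f g _ cf _ cg|c f _ cf] x.
- apply: (@continuous_comp _ _ _ (fun x => dotv x u + b) cos).
    by apply: continuousD; [exact: dotvr_continuous|exact: cst_continuous].
  exact: continuous_cos.
- by apply: continuousD; [exact: cf|exact: cg].
- by apply: continuousM; [exact: cst_continuous|exact: cf].
Qed.

Lemma trigpoly_bounded f : trigpoly f -> exists B, forall x, `|f x| <= B.
Proof.
elim=> {f} [u b|f g _ [B fB] _ [C gC]|c f _ [B fB]].
- by exists 1 => x; exact: cos_max.
- by exists (B + C) => x; rewrite (le_trans (ler_normD _ _))// lerD.
- by exists (`|c| * B) => x; rewrite normrM ler_wpM2l.
Qed.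

Lemma trigpoly_integrable (mu : probability (Rd R d) R) f :
  trigpoly f -> mu.-integrable [set: Rd R d] (EFin \o f).
Proof.
move=> tf; have [B fB] := trigpoly_bounded tf.
apply: (@bounded_integrable R _ (Rd R d) mu f B) => //.
by apply: measurable_fun_Rd; exact: trigpoly_continuous.
Qed.

Variables mu nu : probability (Rd R d) R.

(** Dominated convergence with bound 1. It is applied twice: to n, the degree of the step
    polynomial, and then to m, the scale of the wave. *)
Lemma eq_integral_limit (f_ : nat -> 'rV[R]_d -> R) (f : 'rV[R]_d -> R) :
  (forall n, measurable_fun [set: Rd R d] (f_ n)) ->
  (forall n x, `|f_ n x| <= 1) ->
  (forall x, f_ n x @[n --> \oo] --> f x) ->
  (forall n, (\int[mu]_x (f_ n x)%:E = \int[nu]_x (f_ n x)%:E)%E) ->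
  (\int[mu]_x (f x)%:E = \int[nu]_x (f x)%:E)%E.
Proof.
move=> mf f1 ff munu.
have cvgm (m : probability (Rd R d) R) :
    (\int[m]_x (f_ n x)%:E @[n --> \oo] --> \int[m]_x (f x)%:E)%E.
  apply: (@dominated_cvg _ _ _ m setT measurableT
    (fun n x => (f_ n x)%:E) (fun x => (f x)%:E) (cst 1%E)) => //.
  - by move=> n; apply/measurable_EFinP; exact: mf.
  - by move=> x _; apply: cvg_EFin; [exact: nearW|exact: ff].
  - apply: (@bounded_integrable _ _ _ m (cst 1) 1); first exact: measurable_cst.
    by move=> x; rewrite normr1.
  - by move=> n x _; rewrite abse_EFin lee_fin.
have := cvgm mu; rewrite (funext munu) => cvgmu.
exact: (cvg_unique (@ereal_hausdorff R) cvgmu (cvgm nu)).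
Qed.

(** Equality of the characteristic functions in real form: b = 0 gives the real part, b = - pi / 2
    the imaginary part. *)
Hypothesis cos_eq : forall u b,
  (\int[mu]_x (cos (dotv x u + b))%:E = \int[nu]_x (cos (dotv x u + b))%:E)%E.

Lemma trigpoly_eq_integral f : trigpoly f ->
  (\int[mu]_x (f x)%:E = \int[nu]_x (f x)%:E)%E.
Proof.
elim=> {f} [u b|f g tf IHf tg IHg|c f tf IHf]; first exact: cos_eq.
- have H (m : probability (Rd R d) R) : (\int[m]_x (f x + g x)%:E =
      \int[m]_x (f x)%:E + \int[m]_x (g x)%:E)%E.
    under eq_integral do rewrite EFinD.
    by apply: integralD => //; exact: trigpoly_integrable.
  by rewrite !H IHf IHg.
- have H (m : probability (Rd R d) R) : (\int[m]_x (c * f x)%:E =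
      c%:E * \int[m]_x (f x)%:E)%E.
    under eq_integral do rewrite EFinM.
    by apply: integralZl => //; exact: trigpoly_integrable.
  by rewrite !H IHf.
Qed.

Let wave (a : 'rV[R]_d) (m : nat) (i : 'I_d) (x : 'rV[R]_d) : R :=
  (1 + sin ((x 0 i - a 0 i) / m.+1%:R)) / 2.

Let wave_itv a m i x : 0 <= wave a m i x <= 1.
Proof.
have := sin_max ((x 0 i - a 0 i) / m.+1%:R); rewrite ler_norml => /andP[lo hi].
by rewrite /wave; apply/andP; split; lra.
Qed.

Let trigpoly_wave a m i : trigpoly (wave a m i).
Proof.
apply: eq_trigpoly (trigpolyD (trigpoly_cst 2^-1) (trigpolyZ 2^-1
  (trigpoly_cos (m.+1%:R^-1 *: delta_mx 0 i) (- (a 0 i / m.+1%:R + pi / 2))))) => x.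
rewrite dotvC dotvZl /dotv (bigD1 i)//= big1 ?addr0; last first.
  by move=> j ji; rewrite mxE eqxx (negbTE ji) mul0r.
rewrite mxE !eqxx mul1r /wave -sinDpihalf.
rewrite (_ : _ + pi / 2 = (x 0 i - a 0 i) / m.+1%:R); first by field.
by ring.
Qed.

Let wave_prod a m n x := \prod_(i < d) step_poly n (wave a m i x).

Let wave_prod_norm a m n x : `|wave_prod a m n x| <= 1.
Proof.
rewrite normr_prod; apply: prodr_ile1 => i _; rewrite normr_ge0 /=.
by have /andP[lo hi] := step_poly_itv n (wave_itv a m i x); rewrite ger0_norm.
Qed.

(** The limit of [wave_prod] in n: the indicator of a periodic pattern that agrees with the orthant
    at [a] only within distance (m + 1) pi in each coordinate. *)
Let cutoff a m x : R := \prod_(i < d) (wave a m i x < 2^-1)%R%:R.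

Let measurable_wave_prod a m n : measurable_fun [set: Rd R d] (wave_prod a m n).
Proof.
apply: measurable_fun_Rd; apply: trigpoly_continuous.
by apply: trigpoly_prod => i; exact/trigpoly_step/trigpoly_wave.
Qed.

Let cvg_wave_prod a m x : wave_prod a m n x @[n --> \oo] --> cutoff a m x.
Proof.
apply: cvg_big => [|i _]; first exact: mul_continuous.
exact: cvg_step_poly.
Qed.

Let measurable_cutoff a m : measurable_fun [set: Rd R d] (cutoff a m).
Proof.
by apply: (measurable_fun_cvg (measurable_wave_prod a m)) => x _; exact: cvg_wave_prod.
Qed.

Let cutoff_eq_integral a m :
  (\int[mu]_x (cutoff a m x)%:E = \int[nu]_x (cutoff a m x)%:E)%E.
Proof.
apply: (@eq_integral_limit (wave_prod a m)) => [n|n x|x|n].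
- exact: measurable_wave_prod.
- exact: wave_prod_norm.
- exact: cvg_wave_prod.
- apply: trigpoly_eq_integral.
  by apply: trigpoly_prod => i; exact/trigpoly_step/trigpoly_wave.
Qed.

Let cvg_cutoff a x : cutoff a m x @[m --> \oo] --> (\1_(orthant a) x : R).
Proof.
rewrite (_ : \1_(orthant a) x = \prod_(i < d) (x 0 i < a 0 i)%R%:R); last first.
  rewrite indicE; case: (boolP (x \in _)) => [/set_mem xa|/negP xa].
    by rewrite big1// => i _; rewrite xa.
  have [i /negP/negbTE xai] : exists i, ~ (x 0 i < a 0 i).
    by apply/existsNP => xa'; apply: xa; exact: mem_set.
  by rewrite (bigD1 i)//= xai mul0r.
apply: cvg_big => [|i _]; first exact: mul_continuous.
(* Once |x_i - a_i| < (m + 1) pi, the sine has the sign of x_i - a_i, and the factor no longer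
   changes with m. *)
apply: cvg_near_cst; near=> m.
have m0 : 0 < m.+1%:R :> R by rewrite ltr0n.
have mlarge : `|x 0 i - a 0 i| / m.+1%:R < pi.
  rewrite ltr_pdivrMr// mulrC -ltr_pdivrMr ?pi_gt0//.
  apply: (@lt_trans _ _ m%:R); last by rewrite ltr_nat.
  by near: m; exact: nbhs_infty_gtr.
congr (_%:R); congr nat_of_bool; rewrite /wave.
case: (ltP (x 0 i) (a 0 i)) => xa.
  have s0 : 0 < sin (- ((x 0 i - a 0 i) / m.+1%:R)).
    apply: sin_gt0_pi; rewrite -mulNr opprB divr_gt0 ?subr_gt0//=.
    by move: mlarge; rewrite distrC ger0_norm// subr_ge0 ltW.
  by move: s0; rewrite sinN => s0; apply/idP; lra.
have s0 : 0 <= sin ((x 0 i - a 0 i) / m.+1%:R).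
  apply: sin_ge0_pi; rewrite divr_ge0 ?subr_ge0 ?ler0n//=.
  by move: mlarge; rewrite ger0_norm ?subr_ge0// => /ltW.
by apply/negbTE; rewrite -leNgt; lra.
Unshelve. all: by end_near. Qed.

Lemma cramer_wold (A : set (Rd R d)) : measurable A -> mu A = nu A.
Proof.
apply: eq_measure_orthant => a.
have := @eq_integral_limit (cutoff a) (\1_(orthant a)).
rewrite !integral_indic ?setIT//; try exact: measurable_orthant.
apply.
- exact: measurable_cutoff.
- move=> m x; rewrite normr_prod; apply: prodr_ile1 => i _.
  by rewrite normr_nat ler0n lern1 leq_b1.
- exact: cvg_cutoff.
- exact: cutoff_eq_integral.
Qed.

End cramer_wold.

(** * Admissible constants *)

Section admissible_bound.
Context (R : realType).

Lemma integral_lincomb d (T : measurableType d) (m : probability T R)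
    (K : finType) (a : K -> T -> R) (B : R) (c : K -> R) :
  (forall k, measurable_fun setT (a k)) -> (forall k x, `|a k x| <= B) ->
  (\int[m]_x (\sum_k c k * a k x)%:E =
   (\sum_k c k * fine (\int[m]_x (a k x)%:E))%:E)%E.
Proof.
move=> ma aB.
have ia k : m.-integrable setT (EFin \o a k) by exact: bounded_integrable (aB k).
under eq_integral do rewrite -sumEFin.
rewrite -sumEFin integral_sum//; last first.
  move=> k; rewrite (_ : (fun _ => _) = (fun x => (c k)%:E * (EFin \o a k) x)%E)//.
  exact: integrableZl.
apply: eq_bigr => k _.
under eq_integral do rewrite EFinM.
rewrite integralZl//; last exact: ia.
by rewrite EFinM fineK//; exact: (integrable_fin_num measurableT (ia k)).
Qed.

(** Cauchy-Schwarz against the all-ones vector. *)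
Lemma sqr_sum_le d (c : 'I_d -> R) :
  (\sum_i c i) ^+ 2 <= d%:R * \sum_i c i ^+ 2.
Proof.
have := @cauchy_schwarz_dotv R d (const_mx 1) (\row_i c i).
rewrite -sqrtrM ?dotvv_ge0// -sqrtr_sqr ler_sqrt; last first.
  by rewrite mulr_ge0 ?dotvv_ge0.
rewrite /dotv.
under [X in X ^+ 2 <= _]eq_bigr do rewrite !mxE mul1r.
under [X in _ <= X * _ -> _]eq_bigr do rewrite !mxE mul1r.
under [X in _ <= _ * X -> _]eq_bigr do rewrite !mxE -expr2.
by rewrite sumr_const card_ord.
Qed.

(** Let M = E(t t^T), with entries [m]. Then E (t.t')^2 is the sum of all squared entries of M,
    hence at least that of the diagonal ones, hence at least (tr M)^2 / d = 1 / d. *)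
Lemma admissible_ge d (C : R) : (0 < d)%N -> admissible d C -> d%:R^-1 <= C.
Proof.
move=> d0 [s [sS sC]].
(* Coordinates are set to 0 off the sphere, a null set for s, so that all functions integrated below
   are bounded everywhere. *)
pose e (i : 'I_d) (t : 'rV[R]_d) : R := t 0 i * \1_(@sphere R d) t.
pose a (k : 'I_d * 'I_d) (t : 'rV[R]_d) : R := e k.1 t * e k.2 t.
have mcoord i : measurable_fun [set: Rd R d] (fun t => t 0 i).
  by apply: measurable_fun_Rd; exact: coord_continuous.
have me i : measurable_fun [set: Rd R d] (e i).
  by apply: measurable_funM => //; apply: measurable_indic; exact: measurable_sphere.
have ma k : measurable_fun [set: Rd R d] (a k) by exact: measurable_funM.
have e1 i t : `|e i t| <= 1.
  rewrite /e indicE; case: (boolP (t \in _)) => [/set_mem/sphereP tS|_]; last first.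
    by rewrite mulr0 normr0.
  rewrite mulr1 -(@ler_pXn2r _ 2)// ?nnegrE// expr1n real_normK ?num_real// -tS /dotv.
  by rewrite (bigD1 i)//= -expr2 lerDl; apply: sumr_ge0 => j _; rewrite -expr2 sqr_ge0.
have a1 k t : `|a k t| <= 1 by rewrite normrM mulr_ile1.
pose m k := fine (\int[s]_t (a k t)%:E)%E.
have mE : (\int[s]_t \int[s]_t' (\sum_k a k t * a k t')%:E =
    (\sum_k m k ^+ 2)%:E)%E.
  under eq_integral do rewrite (integral_lincomb _ _ ma a1).
  under eq_integral do under eq_bigr do rewrite mulrC.
  by rewrite (integral_lincomb _ _ ma a1).
have aE t t' : \sum_k a k t * a k t' = (\sum_i e i t * e i t') ^+ 2.
  rewrite expr2 mulr_suml (eq_bigr (fun k : 'I_d * 'I_d =>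
    (e k.1 t * e k.1 t') * (e k.2 t * e k.2 t'))); last by move=> k _; rewrite /a; ring.
  rewrite -(pair_bigA _ (fun i j => (e i t * e i t') * (e j t * e j t')))/=.
  by apply: eq_bigr => i _; rewrite mulr_sumr.
have mdot : measurable_fun [set: Rd R d * Rd R d]
    (fun z => (`|dotv (z.1 : 'rV[R]_d) z.2|)%:E : \bar R).
  apply/measurable_EFinP; apply: measurableT_comp => //.
  apply: measurable_sum => i; apply: measurable_funM.
    by apply: (measurableT_comp (mcoord i)); exact: measurable_fst.
  by apply: (measurableT_comp (mcoord i)); exact: measurable_snd.
have msq : measurable_fun [set: Rd R d * Rd R d]
    (fun z => (\sum_k a k z.1 * a k z.2)%:E : \bar R).
  apply/measurable_EFinP; apply: measurable_sum => k; apply: measurable_funM.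
    by apply: (measurableT_comp (ma k)); exact: measurable_fst.
  by apply: (measurableT_comp (ma k)); exact: measurable_snd.
have sq0 (z : Rd R d * Rd R d) : (0 <= (\sum_k a k z.1 * a k z.2)%:E)%E.
  by rewrite lee_fin aE sqr_ge0.
(* On the sphere |t.t'| <= 1, so the square is at most the absolute value; off it the left side is
   0. *)
have low t t' : \sum_k a k t * a k t' <= `|dotv t t'|.
  rewrite aE /e !indicE.
  case: (boolP (t \in _)) => [/set_mem tS|_]; last first.
    by rewrite big1 ?expr0n/= ?normr_ge0// => i _; rewrite mulr0 mul0r.
  case: (boolP (t' \in _)) => [/set_mem t'S|_]; last first.
    by rewrite big1 ?expr0n/= ?normr_ge0// => i _; rewrite !mulr0.
  under eq_bigr do rewrite !mulr1.
  rewrite -/(dotv t t') -real_normK ?num_real// expr2 ler_piMr//.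
  by rewrite (le_trans (cauchy_schwarz_dotv _ _))// tS t'S mulr1.
have mC : \sum_k m k ^+ 2 <= C.
  rewrite -lee_fin -mE; apply: le_trans sC; apply: ge0_le_integral => //.
  - by move=> t _; apply: integral_ge0 => t' _; exact: (sq0 (t, t')).
  - exact: (@measurable_fun_fubini_tonelli_F _ _ _ _ _ s _ msq sq0).
  - apply: (@measurable_fun_fubini_tonelli_F _ _ _ _ _ s _ mdot) => z.
    by rewrite lee_fin.
  move=> t _; apply: ge0_le_integral => //.
  - by move=> t' _; exact: (sq0 (t, t')).
  - apply/measurable_EFinP; apply: measurable_sum => k.
    by apply: measurable_funM.
  - apply/measurable_EFinP; apply: measurableT_comp => //.
    by rewrite (funext (dotvC t)); exact: measurable_dotv.
  - by move=> t' _; rewrite lee_fin.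
have trace1 : \sum_i m (i, i) = 1.
  apply: EFin_inj.
  transitivity (\int[s]_t (\sum_i 1 * a (i, i) t)%:E)%E.
    rewrite (@integral_lincomb _ (Rd R d) s _ (fun i => a (i, i)) 1 (fun=> 1)
      (fun i => ma (i, i)) (fun i => a1 (i, i))).
    by congr _%:E; apply: eq_bigr => i _; rewrite mul1r.
  rewrite (eq_integral (fun t : Rd R d => (\1_(@sphere R d) t)%:E)).
    rewrite integral_indic ?setIT//; last exact: measurable_sphere.
    have := probability_setC s (measurableC (@measurable_sphere R d)).
    by rewrite setCK sS sube0.
  move=> t _; congr _%:E; rewrite /a /e indicE.
  case: (boolP (t \in _)) => [/set_mem/sphereP tS|_].
    by rewrite -[RHS]tS; apply: eq_bigr => i _ /=; rewrite mul1r !mulr1.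
  by rewrite big1// => i _; rewrite !mulr0.
apply: le_trans mC; rewrite -[leLHS]mulr1 ler_pdivrMl ?ltr0n//.
have := sqr_sum_le (fun i => m (i, i)); rewrite trace1 expr1n => /le_trans; apply.
rewrite ler_wpM2l// -(pair_bigA _ (fun i j => m (i, j) ^+ 2))/=.
apply: ler_sum => i _; rewrite (bigD1 i)//= lerDl.
by apply: sumr_ge0 => j _; rewrite sqr_ge0.
Qed.

End admissible_bound.

(** * Uniform measures on orthonormal bases *)

Section uniform_basis.
Context (R : realType) (d : nat).

(* The rows of the Householder reflection exchanging the first basis vector
   and t; for t equal to that vector the factor (1 - t_0)^-1 is 0^-1 = 0 and
   the reflection degenerates to the identity, as it should. *)
Lemma exists_orthonormal_basis (t : 'rV[R]_d.+1) : dotv t t = 1 ->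
  exists2 b : 'I_d.+1 -> 'rV[R]_d.+1,
    b 0 = t & forall i j, dotv (b i) (b j) = (i == j)%:R.
Proof.
move=> t1; pose e (i : 'I_d.+1) : 'rV[R]_d.+1 := delta_mx 0 i.
have dote x i : dotv x (e i) = x 0 i.
  rewrite /dotv (bigD1 i)//= big1 ?addr0; last first.
    by move=> j ji; rewrite mxE eqxx (negbTE ji) mulr0.
  by rewrite mxE !eqxx mulr1.
(* As [dotv v v = 2 * c], the Householder factor 2 / |v|^2 is [c^-1]. *)
pose v := t - e 0; pose c := 1 - t 0 0.
have vv : dotv v v = 2 * c.
  have tv : dotv t v = c by rewrite /v dotvBr t1 dote.
  have ev : dotv (e 0) v = - c.
    by rewrite /v dotvBr (dotvC _ t) !dote /c mxE !eqxx /=; ring.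
  by rewrite {1}/v dotvDl dotvNl tv ev; ring.
exists (fun i => e i - (v 0 i / c) *: v) => [|i j].
  have [c0|c0] := eqVneq c 0.
    have v0 : v = 0 by apply: dotvv_eq0; rewrite vv c0 mulr0.
    by rewrite v0 scaler0 subr0; move/eqP: v0; rewrite subr_eq0 => /eqP.
  have -> : v 0 0 / c = -1.
    by rewrite !mxE !eqxx/= -(opprB 1) -/c mulNr divff.
  by rewrite scaleN1r opprK addrC subrK.
have dotvZr a x y : dotv x (a *: y) = a * dotv x y by rewrite dotvC dotvZl dotvC.
rewrite dotvBr dote dotvZr (dotvC _ v) dotvBr dote dotvZr vv !mxE.
rewrite eqxx /= (eq_sym j i).
move: (i == j)%:R (t 0 i - _) (t 0 j - _) {dotvZr} => x y z.
have [->|c0] := eqVneq c 0; first by rewrite invr0 !mulr0 !mul0r !subr0.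
by clearbody c; field.
Qed.

(** Take s uniform on an orthonormal basis containing t. Each basis vector is orthogonal to all
    others, so the mean of |x.y| is 1 / d. That t is an atom is expressed by its consequence for
    non-negative functions of integral 0. *)
Lemma exists_MC_atom (C : R) (t : 'rV[R]_d.+1) :
  dotv t t = 1 -> d.+1%:R^-1 <= C ->
  exists2 s : probability (Rd R d.+1) R, MC d.+1 C s &
    forall f : 'rV[R]_d.+1 -> \bar R, measurable_fun [set: Rd R d.+1] f ->
      (forall x, 0 <= f x)%E -> (\int[s]_x f x = 0)%E -> f t = 0%E.
Proof.
move=> t1 dC; have [b b0 bb] := exists_orthonormal_basis t1.
have w0 : 0 <= d.+1%:R^-1 :> R by rewrite invr_ge0.
pose m0 := msum (fun k => \d_(b (inord k) : Rd R d.+1) : measure _ R) d.+1.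
pose m : {measure set (Rd R d.+1) -> \bar R} := mscale (NngNum w0) m0.
have intE (f : 'rV[R]_d.+1 -> \bar R) : measurable_fun [set: Rd R d.+1] f ->
    (forall x, 0 <= f x)%E ->
    (\int[m]_x f x = (d.+1%:R^-1)%:E * \sum_(i < d.+1) f (b i))%E.
  move=> mf f0; rewrite ge0_integral_mscale//; congr (_ * _)%E.
  rewrite ge0_integral_measure_sum//; apply: eq_bigr => i _.
  by rewrite integral_dirac// diracT mul1e inord_val.
have mT : m setT = 1%E.
  rewrite /m /= /mscale/= /m0 /msum/=.
  under eq_bigr do rewrite diracT.
  by rewrite sumEFin sumr_const card_ord -EFinM mulVf.
pose s : probability (Rd R d.+1) R :=
  HB.pack (mscale (NngNum w0) m0) (Measure_isProbability.Build _ _ _ (mscale (NngNum w0) m0) mT).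
have mdot t' : measurable_fun [set: Rd R d.+1]
    (fun x => (`|dotv (t' : 'rV[R]_d.+1) x|)%:E : \bar R).
  apply/measurable_EFinP; apply: measurableT_comp => //.
  by rewrite (funext (dotvC t')); exact: measurable_dotv.
exists s.
  split.
    rewrite /s /= /mscale/= /msum big1 ?mule0// => i _ /=.
    rewrite diracE memNset// => nS; apply: nS.
    by apply/sphereP; rewrite bb eqxx.
  have inner x : (\int[m]_y (`|dotv x y|)%:E =
      (d.+1%:R^-1 * \sum_(i < d.+1) `|dotv x (b i)|)%:E)%E.
    by rewrite intE// sumEFin EFinM.
  rewrite -[leLHS]/(\int[m]_x \int[m]_y (`|dotv x y|)%:E)%E.
  under eq_integral do rewrite inner.
  rewrite intE.
  - rewrite sumEFin -EFinM lee_fin; apply: le_trans dC.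
    rewrite ler_piMr// (eq_bigr (fun=> d.+1%:R^-1)); last first.
      move=> i _; rewrite (bigD1 i)//= big1 ?addr0 ?bb ?eqxx ?normr1 ?mulr1//.
      by move=> j ji; rewrite bb eq_sym (negbTE ji) normr0.
    by rewrite sumr_const card_ord -[X in X *+ _]mul1r -mulrnAr -mulr_natr mul1r mulVf.
  - apply/measurable_EFinP; apply: measurable_funM; first exact: measurable_cst.
    apply: measurable_sum => i; apply: measurableT_comp => //.
    exact: measurable_dotv.
  - by move=> x; rewrite lee_fin mulr_ge0// sumr_ge0.
move=> f mf f0; rewrite -[LHS in LHS = _ -> _]/(\int[m]_x f x)%E intE//.
move=> /eqP; rewrite mule_eq0 eqe invr_eq0 pnatr_eq0 orFb.
rewrite seq_psume_eq0// => /allP/(_ 0 (mem_index_enum _)) /eqP.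
by rewrite b0.
Qed.

End uniform_basis.

(** * The metric axioms *)

Section metric.
Local Open Scope ereal_scope.
Context (R : realType) (d : nat) (p C : R).
Hypothesis p1 : (1 <= p)%R.
Implicit Types mu nu eta : probability (Rd R d) R.

Let p0 : (0 < p)%R. Proof. exact: lt_le_trans p1. Qed.

Lemma le_DSW mu nu s : MC d C s ->
  (\int[s]_t Wpp p (radon mu t) (radon nu t)) `^ p^-1 <= DSW p C mu nu.
Proof. by move=> Cs; apply: ereal_sup_ubound; exists s. Qed.

Lemma DSW_sym mu nu : DSW p C mu nu = DSW p C nu mu.
Proof.
rewrite /DSW; congr ereal_sup; apply: eq_imagel => s _; congr (_ `^ _).
by apply: eq_integral => t _; exact: Wpp_sym.
Qed.

Lemma DSW_ge0 mu nu : admissible d C -> 0 <= DSW p C mu nu.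
Proof. by move=> [s Cs]; apply: le_trans (le_DSW _ _ Cs); exact: poweR_ge0. Qed.

(** On the unit sphere [slicedW] is at most the sum of the two moment norms, a bound that does not
    depend on s. *)
Lemma DSW_fin mu nu : mu \in Pp d p -> nu \in Pp d p -> DSW p C mu nu < +oo.
Proof.
move=> mup nup.
have Mfin : momentN p mu + momentN p nu \is a fin_num.
  by rewrite fin_numD !momentN_fin.
apply: (@le_lt_trans _ _ (momentN p mu + momentN p nu)); last first.
  by rewrite ltey_eq Mfin.
apply: ge_ereal_sup => _ [s [sS _] <-].
rewrite integral_Wpp_radon// -(fineK Mfin); apply: le_Lnorm_cst => //.
- by rewrite fine_ge0// adde_ge0 ?Lnorm_ge0.
- exact: measurable_fine_slicedW.
exists (~` @sphere R d); split => //.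
  by apply: measurableC; exact: measurable_sphere.
move=> t /=; apply: contra_not => t1.
rewrite ger0_norm ?fine_ge0 ?slicedW_ge0// -lee_fin !fineK ?slicedW_fin//.
by apply: (le_trans (slicedW_le p1 _ _ _)); rewrite t1 mul1e.
Qed.

Lemma DSW_triangle mu nu eta :
  mu \in Pp d p -> nu \in Pp d p -> eta \in Pp d p ->
  DSW p C mu nu <= DSW p C mu eta + DSW p C eta nu.
Proof.
move=> mup nup etap; apply: ge_ereal_sup => _ [s Cs <-].
apply: le_trans (leeD (le_DSW mu eta Cs) (le_DSW eta nu Cs)).
rewrite !integral_Wpp_radon//.
set f := fun t => fine (slicedW p mu eta t).
set g := fun t => fine (slicedW p eta nu t).
have mf : measurable_fun [set: Rd R d] f by exact: measurable_fine_slicedW.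
have mg : measurable_fun [set: Rd R d] g by exact: measurable_fine_slicedW.
apply: le_trans (minkowski_EFin s mf mg p1).
rewrite !LnormEFinE; apply: gt0_ler_poweR.
- by rewrite invr_ge0 ltW.
- rewrite in_itv/= leey andbT; apply: integral_ge0 => t _.
  by rewrite lee_fin powR_ge0.
- rewrite in_itv/= leey andbT; apply: integral_ge0 => t _.
  by rewrite lee_fin powR_ge0.
apply: ge0_le_integral => //.
- by apply: measurable_powR_normr; exact: measurable_fine_slicedW.
- by apply: measurable_powR_normr; exact: measurable_funD.
move=> t _; rewrite lee_fin; apply: ge0_ler_powR; rewrite ?nnegrE//.
  exact: ltW.
have W0 m n : (0 <= fine (slicedW p m n t))%R by rewrite fine_ge0// slicedW_ge0.
rewrite !ger0_norm ?addr_ge0 ?W0// /f /g /=.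
rewrite -lee_fin EFinD !fineK ?slicedW_fin//.
exact: Wpp_triangle.
Qed.

(** A [probability] is a function on all sets, so equality of measures means agreement on the
    measurable ones. The law of (x.t, x.t) then couples the projections at cost 0. *)
Lemma DSW_eq0 mu nu : admissible d C ->
  (forall A : set (Rd R d), measurable A -> mu A = nu A) -> DSW p C mu nu = 0.
Proof.
move=> adm munu; apply/eqP; rewrite eq_le DSW_ge0// andbT.
apply: ge_ereal_sup => _ [s _ <-].
rewrite (eq_integral (cst 0)) ?integral0 ?poweR0r ?invr_eq0 ?gt_eqF// => t _.
have := @radon_Wpp_le R d p p1 mu nu t t munu.
rewrite subrr enorm0 mul0e => W0; apply: (@poweR_eq0_eq0 _ _ p^-1).
  exact: Wpp_ge0.
by apply/eqP; rewrite eq_le W0 poweR_ge0.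
Qed.

End metric.

(** Some s in [MC] has t as an atom, and the integral of [Wpp] against it vanishes because its root
    is at most [DSW]. *)
Lemma DSW_eq0_sphere (R : realType) (d : nat) (p C : R)
    (mu nu : probability (Rd R d) R) (t : 'rV[R]_d) : 1 <= p -> (0 < d)%N ->
  admissible d C -> mu \in Pp d p -> nu \in Pp d p ->
  DSW p C mu nu = 0%E -> dotv t t = 1 ->
  Wpp p (radon mu t) (radon nu t) = 0%E.
Proof.
case: d mu nu t => // d mu nu t p1 _ adm mup nup D0 t1.
have p0 : 0 < p by exact: lt_le_trans p1.
have [s Cs atom] := exists_MC_atom t1 (admissible_ge (ltn0Sn d) adm).
apply: (atom (fun t => Wpp p (radon mu t) (radon nu t))) => [|x|].
- rewrite (_ : (fun _ => _) = (fun t => (`|fine (slicedW p mu nu t)| `^ p)%:E)).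
    by apply: measurable_powR_normr; exact: measurable_fine_slicedW.
  apply/funext => x.
  rewrite ger0_norm ?fine_ge0 ?slicedW_ge0// -poweR_EFin fineK ?slicedW_fin//.
  by rewrite /slicedW -poweRrM mulVf ?gt_eqF// poweRe1// Wpp_ge0.
- exact: Wpp_ge0.
apply: (@poweR_eq0_eq0 _ _ p^-1).
  by apply: integral_ge0 => x _; exact: Wpp_ge0.
by apply/eqP; rewrite eq_le poweR_ge0 andbT -D0; exact: le_DSW.
Qed.

(** For u != 0, cos (x.u + b) depends on x only through its projection on u / |u|, as a bounded
    function with Lipschitz constant |u|; [Wpp_eq0_integral] then yields the hypothesis of
    [cramer_wold]. *)
Lemma Wpp_sphere_eq0 (R : realType) (d : nat) (p : R)
    (mu nu : probability (Rd R d) R) : 1 <= p ->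
  (forall t, dotv t t = 1 -> Wpp p (radon mu t) (radon nu t) = 0%E) ->
  forall A : set (Rd R d), measurable A -> mu A = nu A.
Proof.
move=> p1 W0; apply: cramer_wold => u b.
have [->|u0] := eqVneq u 0.
  under eq_integral do rewrite dotv0.
  under [RHS]eq_integral do rewrite dotv0.
  rewrite !integral_cst//; congr (_ * _)%E.
  exact: etrans (probability_setT mu) (esym (probability_setT nu)).
pose c := enorm u; pose t := c^-1 *: u.
have c0 : 0 < c.
  rewrite lt_def enorm_ge0 andbT; apply: contra_neq u0 => /eqP.
  rewrite /c /enorm sqrtr_eq0 => u0; apply: dotvv_eq0; apply/eqP.
  by rewrite eq_le u0 dotvv_ge0.
have uE : u = c *: t by rewrite scalerA divff ?scale1r// gt_eqF.
have t1 : dotv t t = 1.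
  rewrite dotvZl dotvC dotvZl mulrA -expr2 exprVn /c /enorm sqr_sqrtr ?dotvv_ge0//.
  by rewrite mulVf//; apply: contra_neq u0; exact: dotvv_eq0.
pose phi (y : R) := cos (c * y + b).
have mphi : measurable_fun setT phi.
  apply: continuous_measurable_fun => y.
  apply: (@continuous_comp _ _ _ (fun y => c * y + b) cos); last exact: continuous_cos.
  by apply: continuousD; [exact: mulrl_continuous|exact: cst_continuous].
have [P PE] := pushforward_probability mu (@measurable_dotv R d t).
have [Q QE] := pushforward_probability nu (@measurable_dotv R d t).
have WPQ : Wpp p P Q = 0%E.
  rewrite -(W0 t t1); congr (Wpp p _ _); apply/funext => A; [exact: PE|exact: QE].
have push (m : probability (Rd R d) R) (M : probability R R) :
    (forall A, M A = m ((fun x => dotv x t) @^-1` A)) ->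
    (\int[m]_x (cos (dotv x u + b))%:E = \int[M]_y (phi y)%:E)%E.
  move=> ME; pose h (x : Rd R d) := dotv x t.
  have mh : measurable_fun setT h by exact: measurable_dotv.
  have ih : m.-integrable setT ((EFin \o phi) \o h).
    apply: (@bounded_integrable R _ (Rd R d) m (phi \o h) 1) => [|x].
      exact: measurableT_comp.
    exact: cos_max.
  transitivity (\int[m]_x ((EFin \o phi) \o h) x)%E.
    apply: eq_integral => x _.
    by rewrite /= /phi /h {1}uE dotvC dotvZl (dotvC t).
  rewrite -[LHS](@integral_pushforward _ _ _ _ _ h mh m setT)//; last first.
    exact/measurable_EFinP.
  by apply: eq_measure_integral => A mA _; exact/esym/ME.
rewrite (push _ _ PE) (push _ _ QE).
apply: (@Wpp_eq0_integral R p P Q phi c 1) => //.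
- exact: ltW.
- move=> x y; apply: (le_trans (cos_lipschitz _ _)).
  rewrite (_ : _ - _ = c * (x - y)); last by ring.
  by rewrite normrM ger0_norm// ltW.
- by move=> x; exact: cos_max.
Qed.

Theorem theorem1 (R : realType) (d : nat) (p C : R) :
  (2 <= d)%N -> 1 <= p -> 0 < C -> admissible d C ->
  forall mu nu eta : probability (Rd R d) R,
    mu \in Pp d p -> nu \in Pp d p -> eta \in Pp d p ->
    [/\ (0 <= DSW p C mu nu)%E /\ (DSW p C mu nu < +oo)%E,
        DSW p C mu nu = DSW p C nu mu,
        DSW p C mu nu = 0%E <->
          (forall A : set (Rd R d), measurable A -> mu A = nu A)
      & (DSW p C mu nu <= DSW p C mu eta + DSW p C eta nu)%E].
Proof.
move=> d2 p1 _ adm mu nu eta mup nup etap; split.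
- by split; [exact: DSW_ge0|exact: DSW_fin].
- exact: DSW_sym.
- split=> [D0|munu]; last exact: DSW_eq0.
  apply: (Wpp_sphere_eq0 p1) => t t1.
  exact: (DSW_eq0_sphere p1 (ltnW d2) adm mup nup D0 t1).
- exact: DSW_triangle.
Qed.
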